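(* Consider the port-Hamiltonian ODE (pH-ODE) $$E(x)\dot x=(J(x)-R(x))z(x)+B(x)u(t)=f(t,x),\quad x(t_0)=x_0,\qquad y=B(x)^\top z(x),$$ with $f:[t_0,T]\times\mathbb R^n\to\mathbb R^n$ Lipschitz continuous in $x$, and a consistent splitting method $\Psi$ with real step size coefficients $a_1,\dots,a_s$, $b_1,\dots,b_s$, based on a decomposition $f=f^{[1]}+f^{[2]}$ into two subproblems $E(x)\dot x=f^{[i]}(t,x)$, $i=1,2$. Suppose that: (i) both subproblems are pH-ODEs of the form $$E(x)\dot x=(J_i(x)-R_i(x))z(x)+B_i(x)u(t)=f^{[i]}(t,x),\qquad y_i=B_i(x)^\top z(x),$$ where for all $x\in\mathbb R^n$: $J_i(x)=-J_i(x)^\top$, $R_i(x)=R_i(x)^\top\succeq 0$, and $J(x)=J_1(x)+J_2(x)$, $R(x)=R_1(x)+R_2(x)$, $B(x)=B_1(x)+B_2(x)$; (ii) $f^{[1]},f^{[2]}$ are locally Lipschitz continuous in $x$, and $B_1,B_2$ are continuously differentiable; (iii) if $B=0$, then $B_1=B_2=0$; (iv) if $R_1\ne0$, then $a_j\ge0$ for all $j$; (v) if $R_2\ne 0$, then $b_j\ge 0$ for all $j$; (vi) with $r=p$, where $p\le 2$ is the consistency order of $\Psi$: $\mathcal H\in C^{r+1}(\mathbb R^n,\mathbb R)$, $E\in C^r(\mathbb R^n,\mathbb R^{n\times n})$, $B,B_1,B_2\in C^r(\mathbb R^n,\mathbb R^{n\times m})$, $u\in C^r([t_0,T],\mathbb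 R^m)$, and $f,f^{[1]},f^{[2]}:[t_0,T]\times\mathbb R^n\to\mathbb R^n$ are Lipschitz continuous in $x$ if $r=1$ and continuously differentiable if $r=2$. Let $\Psi$ be energy-consistent of order $q\le 2$ for the pH-ODE. If each subflow $\varphi^{[i]}$ in $\Psi$ is replaced by a numerical flow $\psi^{[i]}$ that is energy-consistent to the same or a higher order (for the $i$-th subproblem), $i=1,2$, then the overall method $\Psi^{\mathrm A}$ is energy-consistent of order $q^{\mathrm A}=q$ for the pH-ODE.
   Context: pH-ODE: $J(x)=-J(x)^\top$, $R(x)=R(x)^\top\succeq 0$, $E(x)$ is invertible for all $x\in\mathbb R^n$, and $E(x)^\top z(x)=\nabla\mathcal H(x)$, where $\mathcal H$ is the Hamiltonian (stored energy). Its exact flow is denoted $\varphi_{t,t_0}$. Splitting method: let $\varphi^{[i]}_{t,\sigma}$ be the exact flow of the $i$-th subproblem, i.e. $\varphi^{[i]}_{t,\sigma}(\xi)$ is the value at time $t$ of its solution with value $\xi$ at time $\sigma$. With the scalars $\alpha_k=\sum_{\ell=1}^k a_\ell$, $\beta_k=\sum_{\ell=1}^k b_\ell$, $\alpha_0=\beta_0=0$, the $s$-stage splitting method is $$\Psi_{t_0+h,t_0}=\varphi^{[2]}_{t_0+h\beta_s,\,t_0+h\beta_{s-1}}\circ\varphi^{[1]}_{t_0+h\alpha_s,\,t_0+h\alpha_{s-1}}\circ\cdots\circ\varphi^{[2]}_{t_0+h\beta_1,\,t_0}\circ\varphi^{[1]}_{t_0+h\alpha_1,\,t_0}.$$ It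 is consistent if $\sum_j a_j=\sum_j b_j=1$, and it has consistency order $p$ if $\Psi_{t_0+h,t_0}(x_0)=\varphi_{t_0+h,t_0}(x_0)+\mathcal O(h^{p+1})$. The method $\Psi^{\mathrm A}$ is obtained by replacing every $\varphi^{[i]}_{t,\sigma}$ in this composition by a numerical approximation $\psi^{[i]}_{t,\sigma}$ (a numerical integration scheme for the $i$-th subproblem). Energy consistency: a numerical integration scheme $\Psi$ for a pH-ODE with data $(E,J,R,B,z,u,\mathcal H)$ is energy-consistent if for every $x_0\in\mathbb R^n$ and every step size $h>0$ the approximation $x_1=\Psi_{t_0+h,t_0}(x_0)$ admits a decomposition $\mathcal H(x_1)-\mathcal H(x_0)=\mathcal D_h+\mathcal S_h$ such that (1) $\mathcal D_h\le 0$, with $\mathcal D_h=0$ whenever $R\equiv 0$, and $\mathcal S_h=0$ whenever $B\equiv 0$; (2) $\lim_{h\to0}\mathcal D_h/h=-z(x_0)^\top R(x_0)z(x_0)$ and $\lim_{h\to 0}\mathcal S_h/h=y(t_0)^\top u(t_0)$. It is energy-consistent of order $q\in\mathbb N$ if, with $x(t)=\varphi_{t,t_0}(x_0)$ the exact solution and $y(t)=B(x(t))^\top z(x(t))$, $$\mathcal D_h=\int_{t_0}^{t_0+h}-z(x(\tau))^\top R(x(\tau))z(x(\tau))\,d\tau+\mathcal O(h^{q+1}),\qquad \mathcal S_h=\int_{t_0}^{t_0+h}y(\tau)^\top u(\tau)\,d\tau+\mathcal O(h^{q+1}).$$ For $\psi^{[i]}$ these notions refer to the $i$-th subproblem (data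 $J_i,R_i,B_i$, output $y_i$, exact flow $\varphi^{[i]}$).
   Formalization: Each ψ^[i] is also assumed consistent (ψ^[i]=φ^[i]+O(h²), identity for step 0) and energy-consistent for the negative step sizes that occur; O-terms are uniform in the initial time and on bounded sets of initial values; all substep times lie in [t0,T]. *)

(* Defs.v *)
From mathcomp Require Export all_boot all_order all_algebra.
From mathcomp Require Export all_classical all_reals all_analysis.

Set Implicit Arguments.
Unset Strict Implicit.
Unset Printing Implicit Defensive.

Export Order.TTheory GRing.Theory Num.Theory.
Export numFieldNormedType.Exports.

Local Open Scope classical_set_scope.
Local Open Scope ring_scope.

(* In finite dimension, continuity of x |-> 'd f x v for every v is continuity
   of the differential in operator norm. *)
Fixpoint Ck (R : realType) (V W : normedModType R) (k : nat) (f : V -> W)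
    : Prop :=
  if k is k'.+1 then
    (forall x, differentiable f x) /\ forall v, Ck k' (fun x => 'd f x v)
  else continuous f.

(* C^k on a closed set: restriction of a C^k function of the whole space.  On
   [t0, T] and [t0, T] x R^n this agrees with one-sided derivatives at the
   endpoints. *)
Definition Ck_on (R : realType) (V W : normedModType R) (k : nat) (A : set V)
    (f : V -> W) : Prop :=
  exists2 g : V -> W, Ck k g & forall x, A x -> f x = g x.

(* Lipschitz continuity in x of g(t, x), uniform in t in [t0, T]. *)
Definition lipschitz_in_x (R : realType) (V W : normedModType R) (t0 T : R)
    (g : R -> V -> W) : Prop :=
  exists L : R, forall t, t \in `[t0, T] -> L.-lipschitz_setT (g t).

Definition locally_lipschitz_in_x (R : realType) (V W : normedModType R)
    (t0 T : R) (g : R -> V -> W) : Prop :=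
  forall x : V, exists (L : R) (U : set V), nbhs x U /\
    forall t, t \in `[t0, T] -> L.-lipschitz_U (g t).

Definition oriented_integral (R : realType) (f : R -> R) (a b : R) : R :=
  if a <= b then \int[lebesgue_measure]_(x in `[a, b]) f x
  else - \int[lebesgue_measure]_(x in `[b, a]) f x.

Definition gradient (R : realType) (n : nat) (H : 'cV[R]_n -> R)
    (x : 'cV[R]_n) : 'cV[R]_n :=
  \col_i 'D_(delta_mx i 0) H x.

Definition dot (R : realType) (k : nat) (v w : 'cV[R]_k) : R :=
  (v^T *m w) 0 0.

Definition psd (R : realType) (n : nat) (A : 'M[R]_n) : Prop :=
  A^T = A /\ forall v : 'cV[R]_n, 0 <= dot v (A *m v).

Record ph_data (R : realType) (n m : nat) := PHData {
  phE : 'cV[R]_n -> 'M[R]_n;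
  phJ : 'cV[R]_n -> 'M[R]_n;
  phR : 'cV[R]_n -> 'M[R]_n;
  phB : 'cV[R]_n -> 'M[R]_(n, m);
  phz : 'cV[R]_n -> 'cV[R]_n;
  phu : R -> 'cV[R]_m;
  phH : 'cV[R]_n -> R
}.

Definition ph_rhs (R : realType) (n m : nat) (P : ph_data R n m) (t : R)
    (x : 'cV[R]_n) : 'cV[R]_n :=
  (phJ P x - phR P x) *m phz P x + phB P x *m phu P t.

Definition ph_output (R : realType) (n m : nat) (P : ph_data R n m)
    (x : 'cV[R]_n) : 'cV[R]_m :=
  (phB P x)^T *m phz P x.

Definition is_pH (R : realType) (n m : nat) (P : ph_data R n m) : Prop :=
  [/\ forall x, phJ P x = - (phJ P x)^T,
      forall x, psd (phR P x),
      forall x, phE P x \in unitmx,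
      forall x, differentiable (phH P) x
    & forall x, (phE P x)^T *m phz P x = gradient (phH P) x].

(* -z^T R z, so nonpositive for a pH-ODE. *)
Definition dissipation (R : realType) (n m : nat) (P : ph_data R n m)
    (x : 'cV[R]_n) : R :=
  - dot (phz P x) (phR P x *m phz P x).

Definition supply (R : realType) (n m : nat) (P : ph_data R n m) (t : R)
    (x : 'cV[R]_n) : R :=
  dot (ph_output P x) (phu P t).

(* Solutions of E(x) x' = f(t, x) on the interval between s and t, for s <= t
   or t <= s.  At the endpoints only continuity is required; the one-sided
   derivatives then follow from the equation. *)
Definition solution_between (R : realType) (n m : nat) (P : ph_data R n m)
    (s t : R) (x : R -> 'cV[R]_n) : Prop :=
  let lo := Num.min s t in let hi := Num.max s t in
  {within `[lo, hi], continuous x} /\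
  forall tau, tau \in `]lo, hi[ ->
    derivable x tau 1 /\ phE P (x tau) *m 'D_1 x tau = ph_rhs P tau (x tau).

(* A flow map is written phi t s xi, for the state
   at time t reached from the state xi at time s, and is partial: solutions may
   blow up, and a numerical step may fail to be defined. *)

Definition flow_map (R : realType) (n : nat) :=
  R -> R -> 'cV[R]_n -> option 'cV[R]_n.

Definition exact_flow (R : realType) (n m : nat) (t0 T : R)
    (P : ph_data R n m) : flow_map R n :=
  fun t s xi => xget None
    [set Some eta | eta in [set eta | s \in `[t0, T] /\ t \in `[t0, T] /\
       exists x, [/\ solution_between P s t x, x s = xi & x t = eta]]].

(* Coefficients are indexed from 0, so partial_sum c k is alpha_k (beta_k). *)
Definition partial_sum (R : realType) (s : nat) (c : 'I_s -> R) (k : nat) : R :=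
  \sum_(l < s | (l < k)%N) c l.

(* Psi_{sg+h,sg} with h = t - sg *)
Definition splitting_method (R : realType) (n s : nat) (a b : 'I_s -> R)
    (phi1 phi2 : flow_map R n) : flow_map R n :=
  fun t sg xi =>
    let at_ c k := sg + (t - sg) * partial_sum c k in
    foldl (fun x k => obind (phi2 (at_ b k.+1) (at_ b k))
                        (obind (phi1 (at_ a k.+1) (at_ a k)) x))
          (Some xi) (iota 0 s).

(* The pairs (sg, h) of an initial time and a step size h > 0 for which the
   splitting method only evaluates the right-hand sides in [t0, T].  If all
   alpha_k and beta_k are in [0, 1], these are all h > 0 with sg and sg + h in
   [t0, T]. *)
Definition splitting_step (R : realType) (s : nat) (t0 T : R) (a b : 'I_s -> R)
    (sg h : R) : Prop :=
  [/\ 0 < h, sg \in `[t0, T], sg + h \in `[t0, T]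
    & forall k, (k <= s)%N ->
        sg + h * partial_sum a k \in `[t0, T] /\
        sg + h * partial_sum b k \in `[t0, T]].

(* The pairs (sg, k) of an initial time and a step size for the scheme that
   plays the role of the subflow with coefficients c.  If all c_j are
   nonnegative (and some c_j is not 0), these are all k > 0; negative step sizes
   occur exactly when some c_j is negative. *)
Definition substep (R : realType) (s : nat) (t0 T : R) (c : 'I_s -> R)
    (sg k : R) : Prop :=
  [/\ k != 0, exists (j : 'I_s) (h : R), 0 < h /\ k = h * c j,
      sg \in `[t0, T] & sg + k \in `[t0, T]].

(* In the notions below, step sg h says that h is a step size to be considered
   at the initial time sg; O-terms are for h -> 0, uniformly in sg and locally
   uniformly in the initial state. *)

Definition consistency_order (R : realType) (n m : nat) (t0 T : R)
    (P : ph_data R n m) (step : R -> R -> Prop) (Psi : flow_map R n)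
    (p : nat) : Prop :=
  forall rho : R, exists C delta : R, 0 < delta /\
    forall sg h xi, step sg h -> `|h| <= delta -> `|xi| <= rho ->
      exists x1 x : 'cV[R]_n,
        [/\ Psi (sg + h) sg xi = Some x1,
            exact_flow t0 T P (sg + h) sg xi = Some x
          & `|x1 - x| <= C * `|h| ^+ p.+1].

(* Approximations of the exact flow: consistent one-step schemes. *)
Definition numerical_flow (R : realType) (n m : nat) (t0 T : R)
    (P : ph_data R n m) (step : R -> R -> Prop) (psi : flow_map R n) : Prop :=
  (forall sg xi, sg \in `[t0, T] -> psi sg sg xi = Some xi) /\
  consistency_order t0 T P step psi 1.

(* Energy consistency, with D sg h xi and S sg h xi for the terms D_h and S_h of
   the step of size h from the state xi at time sg. *)
Definition energy_decomposition (R : realType) (n m : nat) (P : ph_data R n m)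
    (step : R -> R -> Prop) (Psi : flow_map R n)
    (D S : R -> R -> 'cV[R]_n -> R) : Prop :=
  (forall sg h x0 x1, step sg h -> Psi (sg + h) sg x0 = Some x1 ->
     [/\ phH P x1 - phH P x0 = D sg h x0 + S sg h x0,
         D sg h x0 <= 0,
         (forall x, phR P x = 0) -> D sg h x0 = 0
       & (forall x, phB P x = 0) -> S sg h x0 = 0]) /\
  (forall sg x0,
     D sg h x0 / h @[h --> within (step sg) (nbhs 0)] --> dissipation P x0 /\
     S sg h x0 / h @[h --> within (step sg) (nbhs 0)] --> supply P sg x0).

Definition energy_consistent_of_order (R : realType) (n m : nat)
    (P : ph_data R n m) (step : R -> R -> Prop) (Psi : flow_map R n)
    (q : nat) : Prop :=
  exists D S : R -> R -> 'cV[R]_n -> R,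
    energy_decomposition P step Psi D S /\
    forall rho : R, exists C delta : R, 0 < delta /\
      forall sg h x0, step sg h -> `|h| <= delta -> `|x0| <= rho ->
        exists (x1 : 'cV[R]_n) (x : R -> 'cV[R]_n),
          [/\ Psi (sg + h) sg x0 = Some x1,
              solution_between P sg (sg + h) x /\ x sg = x0,
              `|D sg h x0 - oriented_integral
                  (fun tau => dissipation P (x tau)) sg (sg + h)|
                <= C * `|h| ^+ q.+1
            & `|S sg h x0 - oriented_integral
                  (fun tau => supply P tau (x tau)) sg (sg + h)|
                <= C * `|h| ^+ q.+1].

(* Main.v *)
Require Import Defs.
From mathcomp Require Import ring lra.

Set Implicit Arguments.
Unset Strict Implicit.
Unset Printing Implicit Defensive.

Local Open Scope classical_set_scope.
Local Open Scope ring_scope.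

(** In substep i the energy changes by the integral of the locally Lipschitz
    function (t, x) |-> dissipation + supply along the i-th flow, up to
    O(h^(q+1)) for the numerical scheme.  The numerical and the exact
    intermediate states differ by O(h^2), and over a substep of length O(h)
    this perturbs the energy increment by O(h^3) only.  Summing over the
    substeps, H changes along the two splitting methods by the same amount up
    to O(h^(q+1)), as q <= 2.

    It remains to split this change into D and S.  If B is not identically 0,
    the dissipation part of the exact splitting method is kept and the supply
    part absorbs the perturbation.  If B = 0, everything is dissipation; its
    sign follows by adding the substeps, in which the supply vanishes because
    B1 = B2 = 0, and R = 0 forces R1 = R2 = 0. *)

(** * Functions that are Lipschitz continuous on balls *)

Lemma near_dist_le (R : realType) (V : normedModType R) (x : V) (e : R) :
  0 < e -> \forall y \near x, `|x - y| <= e.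
Proof.
by move=> e0; apply: filterS (nbhsx_ballx x _ e0) => y; rewrite -ball_normE => /ltW.
Qed.

Section MatrixNorm.
Variables (R : realType) (m n : nat).

Lemma ler_entry_mx_norm (A : 'M[R]_(m, n)) i j : `|A i j| <= `|A|.
Proof.
rewrite [leRHS]/Num.norm /= mx_normrE; apply/bigmax_geP; right => /=.
by exists (i, j).
Qed.

Lemma mx_norm_le (A : 'M[R]_(m, n)) (c : R) :
  0 <= c -> (forall i j, `|A i j| <= c) -> `|A| <= c.
Proof.
move=> c0 Ac; rewrite [leLHS]/Num.norm /= mx_normrE.
by apply/bigmax_leP; split.
Qed.

End MatrixNorm.

(** Bounded closed sets of row vectors are compact; transposition is continuous and does not
    increase the norm in either direction, so it maps the ball of row vectors onto that of column
    vectors. *)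
Lemma closed_ball_cV_compact (R : realType) n (rho : R) :
  compact [set x : 'cV[R]_n | `|x| <= rho].
Proof.
have trc : continuous (@trmx R 1 n).
  move=> v; apply/(cvgrPdist_le (FF := nbhs_filter v)) => e e0.
  apply: filterS (@near_dist_le R 'rV[R]_n v e e0) => w vw.
  rewrite -linearB; apply: mx_norm_le (ltW e0) _ => i j; rewrite mxE.
  by apply: le_trans (ler_entry_mx_norm _ _ _) _.
have -> : [set x : 'cV[R]_n | `|x| <= rho] =
    @trmx R 1 n @` [set v : 'rV[R]_n | `|v| <= rho].
  have trn k l (A : 'M[R]_(k, l)) : `|A^T| <= `|A|.
    apply: mx_norm_le => // i j.
    by rewrite mxE; exact: ler_entry_mx_norm.
  apply/seteqP; split=> [x /= xr|_ [v /= vr <-]]; last exact: le_trans (trn _ _ _) vr.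
  by exists x^T; [exact: le_trans (trn _ _ _) xr|rewrite trmxK].
apply: continuous_compact; first exact: continuous_subspaceT.
apply: bounded_closed_compact.
  exists rho; split; first exact: num_real.
  by move=> M rM v /= vr; exact: le_trans vr (ltW rM).
have -> : [set v : 'rV[R]_n | `|v| <= rho] =
   (fun v : 'rV[R]_n => `|v|) @^-1` [set r | r <= rho] by [].
by apply: closed_comp (@closed_le _ rho) => v _; exact: norm_continuous.
Qed.

Section LipschitzOnBalls.
Variable R : realType.

(** The constant may grow with the radius, which makes the class stable under products. On column
    vectors this is local Lipschitz continuity, by [lip_on_balls_local]. *)
Definition lip_on_balls (V : normedModType R) (f : V -> R) : Prop :=
  forall rho, exists2 L, 0 <= L &
    forall x y, `|x| <= rho -> `|y| <= rho -> `|f x - f y| <= L * `|x - y|.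

Lemma lip_on_balls_bounded (V : normedModType R) (f : V -> R) (rho : R) :
  lip_on_balls f -> exists2 M, 0 <= M & forall x, `|x| <= rho -> `|f x| <= M.
Proof.
move=> /(_ `|rho|)[L L0 fL]; exists (`|f 0| + L * `|rho|).
  by rewrite addr_ge0// mulr_ge0.
move=> x xr; rewrite -[f x](subrK (f 0)) addrC (le_trans (ler_normD _ _))//.
rewrite lerD2l; have xr' : `|x| <= `|rho| by rewrite (le_trans xr)// ler_norm.
apply: le_trans (fL _ _ xr' _) _; first by rewrite normr0.
by rewrite subr0 ler_wpM2l.
Qed.

Lemma lip_on_balls_continuous (V : normedModType R) (f : V -> R) :
  lip_on_balls f -> continuous f.
Proof.
move=> lf x; have [L L0 fL] := lf (`|x| + 1).
have L1 : 0 < L + 1 by rewrite ltr_wpDl.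
apply/cvgrPdist_le => e e0; near=> y.
have xy1 : `|x - y| <= 1.
  by near: y; exact: near_dist_le.
have yx : `|y| <= `|x| + 1.
  by rewrite -[y](subrK x) addrC (le_trans (ler_normD _ _))// lerD2l distrC.
apply: le_trans (fL _ _ _ yx) _; first by rewrite lerDl.
apply: (@le_trans _ _ ((L + 1) * `|x - y|)); first by rewrite ler_wpM2r// lerDl.
rewrite mulrC -ler_pdivlMr//.
by near: y; apply: near_dist_le (divr_gt0 e0 L1).
Unshelve. all: by end_near. Qed.

Lemma lip_on_balls_cst (V : normedModType R) (c : R) :
  lip_on_balls (fun _ : V => c).
Proof. by move=> rho; exists 0 => // x y _ _; rewrite subrr normr0 mul0r. Qed.

Lemma lip_on_ballsD (V : normedModType R) (f g : V -> R) :
  lip_on_balls f -> lip_on_balls g -> lip_on_balls (fun x => f x + g x).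
Proof.
move=> lf lg rho; have [L L0 fL] := lf rho; have [K K0 gK] := lg rho.
exists (L + K) => [|x y xr yr]; first exact: addr_ge0.
rewrite opprD addrACA mulrDl (le_trans (ler_normD _ _))//.
by rewrite lerD ?fL ?gK.
Qed.

Lemma lip_on_ballsM (V : normedModType R) (f g : V -> R) :
  lip_on_balls f -> lip_on_balls g -> lip_on_balls (fun x => f x * g x).
Proof.
move=> lf lg rho; have [L L0 fL] := lf rho; have [K K0 gK] := lg rho.
have [M M0 fM] := lip_on_balls_bounded rho lf.
have [N N0 gN] := lip_on_balls_bounded rho lg.
exists (M * K + N * L) => [|x y xr yr]; first by rewrite addr_ge0// mulr_ge0.
have -> : f x * g x - f y * g y = f x * (g x - g y) + g y * (f x - f y) by ring.
rewrite mulrDl (le_trans (ler_normD _ _))// !normrM -!mulrA.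
by rewrite lerD// ler_pM// ?fM ?gN ?fL ?gK.
Qed.

Lemma lip_on_ballsN (V : normedModType R) (f : V -> R) :
  lip_on_balls f -> lip_on_balls (fun x => - f x).
Proof.
move=> lf; have := lip_on_ballsM (@lip_on_balls_cst V (-1)) lf.
by congr lip_on_balls; apply/funext => x; rewrite mulN1r.
Qed.

Lemma lip_on_balls_sum (V : normedModType R) I (r : seq I) (P : pred I)
    (F : I -> V -> R) :
  (forall i, P i -> lip_on_balls (F i)) ->
  lip_on_balls (fun x => \sum_(i <- r | P i) F i x).
Proof.
move=> lF; elim: r => [|i r IH].
  by under eq_fun => x do rewrite big_nil; exact: lip_on_balls_cst.
under eq_fun => x do rewrite big_cons.
by case: (boolP (P i)) => // Pi; exact: lip_on_ballsD (lF _ Pi) IH.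
Qed.

Lemma lip_on_balls_prod (V : normedModType R) I (r : seq I) (P : pred I)
    (F : I -> V -> R) :
  (forall i, P i -> lip_on_balls (F i)) ->
  lip_on_balls (fun x => \prod_(i <- r | P i) F i x).
Proof.
move=> lF; elim: r => [|i r IH].
  by under eq_fun => x do rewrite big_nil; exact: lip_on_balls_cst.
under eq_fun => x do rewrite big_cons.
by case: (boolP (P i)) => // Pi; exact: lip_on_ballsM (lF _ Pi) IH.
Qed.

(** Compactness of the ball in its near-covering form, with the bound [M] running to infinity. *)
Lemma locally_bounded_cV n (f : 'cV[R]_n -> R) :
  (forall x : 'cV[R]_n, exists M U, nbhs x U /\ forall y, U y -> `|f y| <= M) ->
  forall rho, exists2 M, 0 <= M & forall x, `|x| <= rho -> `|f x| <= M.
Proof.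
move=> lf rho.
have /compact_near_coveringP/(_ _ (+oo_R) (fun M y => `|f y| <= M)) :=
  @closed_ball_cV_compact R n rho.
move=> near_M; have [|M0 [_ HM]] := near_M _.
  move=> x _; have [M [U [xU fM]]] := lf x.
  exists (U, [set N | M <= N]) => /=.
    by split => //; exists M; split; [exact: num_real|move=> ? /ltW].
  by move=> [y N] /= [Uy MN]; exact: le_trans (fM _ Uy) MN.
exists (Num.max M0 0 + 1) => [|x]; first by rewrite addr_ge0// le_max lexx orbT.
by apply: HM; rewrite ltr_pwDr// le_max lexx.
Qed.

(** By compactness it suffices to compare points near a fixed [x] with all points [w] of the ball. A
    nearby [w] lies in the neighbourhood where [f] is Lipschitz; for a distant one the boundedness
    of [f] on the ball is enough. *)
Lemma lip_on_balls_local n (f : 'cV[R]_n -> R) :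
  (forall x : 'cV[R]_n, exists L U, nbhs x U /\
     forall y w, U y -> U w -> `|f y - f w| <= L * `|y - w|) ->
  lip_on_balls f.
Proof.
move=> lf rho.
have [M M0 fM] : exists2 M, 0 <= M & forall x, `|x| <= rho -> `|f x| <= M.
  apply: locally_bounded_cV => x; have [L [U [xU fL]]] := lf x.
  exists (`|f x| + `|L|), (U `&` ball x 1).
  split; first by apply: filterI => //; exact: nbhsx_ballx.
  move=> y [Uy xy1]; rewrite -[f y](subrK (f x)) addrC (le_trans (ler_normD _ _))//.
  rewrite lerD2l (le_trans (fL _ _ Uy (nbhs_singleton xU)))//.
  rewrite (le_trans (ler_norm _))// normrM normr_id ler_piMr//.
  by rewrite distrC; move: xy1; rewrite -ball_normE => /ltW.
have /compact_near_coveringP/(_ _ (+oo_R) (fun L y =>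
    forall w : 'cV[R]_n, `|y| <= rho -> `|w| <= rho ->
      `|f y - f w| <= L * `|y - w|)) := @closed_ball_cV_compact R n rho.
move=> near_L; have [|L0 [_ HL]] := near_L _.
  move=> x _; have [L [U [xU fL]]] := lf x.
  have [e /= e0 eU] : exists2 e : R, 0 < e & ball x e `<=` U by apply/nbhs_ballP.
  (* The second bound serves the pairs at distance at least [e / 2]: the values differ by at most
     [2 * M], which is [4 * M / e * (e / 2)]. *)
  exists (ball x (e / 2), [set N | Num.max `|L| (4 * M / e) <= N]) => /=.
    split; first by apply: nbhsx_ballx; rewrite divr_gt0.
    by exists (Num.max `|L| (4 * M / e)); split; [exact: num_real|move=> ? /ltW].
  move=> [y N] /= []; rewrite -ball_normE /= => xy LN w yr wr.
  have xye : `|x - y| < e by lra.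
  have N1 : `|L| <= N by rewrite (le_trans _ LN)// le_max lexx.
  have N2 : 4 * M / e <= N by rewrite (le_trans _ LN)// le_max lexx orbT.
  have [yw|yw] := ltP `|y - w| (e / 2).
    have xw : `|x - w| < e.
      by rewrite -(subrKA y) (le_lt_trans (ler_normD _ _))// [ltRHS]splitr ltrD.
    apply: le_trans (fL _ _ (eU _ _) (eU _ _)) _; try by rewrite -ball_normE.
    by rewrite ler_wpM2r// (le_trans (ler_norm _)).
  apply: le_trans (ler_normB _ _) _.
  apply: (@le_trans _ _ (4 * M / e * (e / 2))).
    have -> : 4 * M / e * (e / 2) = M + M by field; rewrite gt_eqF.
    by rewrite lerD ?fM.
  rewrite ler_pM//; last by rewrite divr_ge0// ltW.
  by rewrite divr_ge0 ?mulr_ge0 ?(ltW e0).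
exists (Num.max L0 0 + 1) => [|x y xr yr].
  by rewrite addr_ge0// le_max lexx orbT.
by apply: HL => //; rewrite ltr_pwDr// le_max lexx.
Qed.

(** Near [x] the modulus of [f] stays above half its value [c] at [x], so the difference of the
    inverses, a difference of [f] over a product of two values, has the local constant [L / (c * c)]
    with [c] that half. *)
Lemma lip_on_ballsV n (f : 'cV[R]_n -> R) :
  lip_on_balls f -> (forall x, f x != 0) -> lip_on_balls (fun x => (f x)^-1).
Proof.
move=> lf f0; apply: lip_on_balls_local => x.
have [L L0 fL] := lf (`|x| + 1).
pose c := `|f x| / 2; have c0 : 0 < c by rewrite divr_gt0// normr_gt0.
exists (L / (c * c)), (ball x 1 `&` [set y | c <= `|f y|]); split.
  apply: filterI; first exact: nbhsx_ballx.
  have cf : (fun y => `|f y|) @ x --> `|f x|.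
    have fx : f y @[y --> x] --> f x by apply: lip_on_balls_continuous.
    exact: cvg_norm fx.
  apply: (cvgr_ge _ cf); rewrite /c ltr_pdivrMr// ltr_pMr ?normr_gt0//.
  by rewrite ltr1n.
move=> y w [xy cy] [xw cw].
have inb v : ball x 1 v -> `|v| <= `|x| + 1.
  rewrite -ball_normE /= => xv.
  by rewrite -[v](subrK x) addrC (le_trans (ler_normD _ _))// lerD2l distrC ltW.
have -> : (f y)^-1 - (f w)^-1 = (f w - f y) / (f y * f w).
  by field; rewrite !f0.
rewrite normrM normfV normrM mulrAC ler_pM// ?invr_ge0 ?mulr_ge0//.
  by rewrite distrC fL ?inb.
rewrite lef_pV2 ?posrE ?mulr_gt0 ?normr_gt0//.
by rewrite ler_pM// ltW.
Qed.

End LipschitzOnBalls.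

(** * Derivatives along curves, matrix-valued maps and continuously differentiable functions *)

Lemma is_derive_affine (R : realType) (V : normedModType R) (w v : V) (t : R) :
  is_derive t 1 (fun r => w + r *: v) v.
Proof.
have dv : h^-1 *: (((fun r => w + r *: v) \o shift t) (h *: 1) - (w + t *: v))
    @[h --> 0^'] --> v.
  apply: cvg_near_cst; near=> h.
  rewrite /= -[h *: 1]/(h * 1) mulr1 opprD addrACA subrr add0r -scalerBl.
  rewrite addrK scalerA mulVf ?scale1r//.
  by near: h; exact: nbhs_dnbhs_neq.
by split; [apply: cvgP dv|exact: cvg_lim dv].
Unshelve. all: by end_near. Qed.

Lemma is_derive_chain (R : realType) (V W : normedModType R) (f : V -> W)
    (c : R -> V) (t : R) (v : V) :
  differentiable f (c t) -> is_derive t 1 c v ->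
  is_derive t 1 (f \o c) ('d f (c t) v).
Proof.
move=> df [/derivable1_diffP dc <-].
have dfc : differentiable (f \o c) t by exact: differentiable_comp.
split; first by apply/derivable1_diffP.
by rewrite deriveE// diff_comp//= deriveE.
Qed.

Section MatrixValued.
Variable R : realType.

Definition mx_lip_on_balls (V : normedModType R) k l (F : V -> 'M[R]_(k, l)) :=
  forall i j, lip_on_balls (fun x => F x i j).

Lemma mx_lip_on_ballsB (V : normedModType R) k l (F G : V -> 'M[R]_(k, l)) :
  mx_lip_on_balls F -> mx_lip_on_balls G ->
  mx_lip_on_balls (fun x => F x - G x).
Proof.
move=> lF lG i j; have := lip_on_ballsD (lF i j) (lip_on_ballsN (lG i j)).
by congr lip_on_balls; apply/funext => x; rewrite !mxE.
Qed.

Lemma mx_lip_on_ballsM (V : normedModType R) k l r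
    (F : V -> 'M[R]_(k, l)) (G : V -> 'M[R]_(l, r)) :
  mx_lip_on_balls F -> mx_lip_on_balls G ->
  mx_lip_on_balls (fun x => F x *m G x).
Proof.
move=> lF lG i j; under eq_fun => x do rewrite mxE.
by apply: lip_on_balls_sum => a _; apply: lip_on_ballsM.
Qed.

Lemma mx_lip_on_balls_cst (V : normedModType R) k l (A : 'M[R]_(k, l)) :
  mx_lip_on_balls (fun _ : V => A).
Proof. by move=> i j; exact: lip_on_balls_cst. Qed.

Lemma mx_lip_on_ballsT (V : normedModType R) k l (F : V -> 'M[R]_(k, l)) :
  mx_lip_on_balls F -> mx_lip_on_balls (fun x => (F x)^T).
Proof. by move=> lF i j; under eq_fun => x do rewrite mxE; exact: lF. Qed.

Lemma lip_on_balls_det (V : normedModType R) k (F : V -> 'M[R]_k) :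
  mx_lip_on_balls F -> lip_on_balls (fun x => \det (F x)).
Proof.
move=> lF; apply: lip_on_balls_sum => s _; apply: lip_on_ballsM.
  exact: lip_on_balls_cst.
by apply: lip_on_balls_prod => i _; apply: lF.
Qed.

(** By Cramer's rule the entries of the inverse are cofactors over the determinant, hence
    polynomials in the entries of [F] over a function without zeros. *)
Lemma mx_lip_on_ballsV n k (F : 'cV[R]_n -> 'M[R]_k) :
  mx_lip_on_balls F -> (forall x, F x \in unitmx) ->
  mx_lip_on_balls (fun x => invmx (F x)).
Proof.
move=> lF uF i j.
under eq_fun => x do rewrite /invmx uF !mxE.
have d0 x : \det (F x) != 0 by rewrite -unitfE -unitmxE.
apply: lip_on_ballsM; first exact: lip_on_ballsV (lip_on_balls_det lF) d0.
apply: lip_on_ballsM; first exact: lip_on_balls_cst.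
apply: lip_on_balls_det => a b.
by under eq_fun => x do rewrite !mxE; exact: lF.
Qed.

Lemma mx_lip_on_balls_norm (V : normedModType R) k l (F : V -> 'M[R]_(k, l)) rho :
  mx_lip_on_balls F -> exists2 L, 0 <= L & forall x y, `|x| <= rho ->
    `|y| <= rho -> `|F x - F y| <= L * `|x - y|.
Proof.
move=> lF.
have /choice[L LP] : forall ij : 'I_k * 'I_l, exists L, 0 <= L /\ forall x y,
    `|x| <= rho -> `|y| <= rho ->
    `|F x ij.1 ij.2 - F y ij.1 ij.2| <= L * `|x - y|.
  by move=> ij; have [L L0 HL] := lF ij.1 ij.2 rho; exists L.
exists (\sum_ij L ij) => [|x y xr yr]; first by apply: sumr_ge0 => ij _; exact: (LP ij).1.
have S0 : 0 <= \sum_ij L ij by apply: sumr_ge0 => ij _; exact: (LP ij).1.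
apply: mx_norm_le => [|i j]; first exact: mulr_ge0.
rewrite !mxE; apply: le_trans ((LP (i, j)).2 _ _ xr yr) _.
rewrite ler_wpM2r// (bigD1 (i, j))//= lerDl.
by apply: sumr_ge0 => ij _; exact: (LP ij).1.
Qed.

(** The norm is the largest modulus of an entry, so the inner dimension [l] appears as the number of
    summands in an entry of the product. *)
Lemma mulmx_norm k l r (A : 'M[R]_(k, l)) (B : 'M[R]_(l, r)) :
  `|A *m B| <= l%:R * (`|A| * `|B|).
Proof.
apply: mx_norm_le => [|i j]; first by rewrite !mulr_ge0.
rewrite mxE (le_trans (ler_norm_sum _ _ _))//.
have -> : l%:R * (`|A| * `|B|) = \sum_(a < l) `|A| * `|B|.
  by rewrite sumr_const card_ord mulr_natl.
rewrite ler_sum// => a _.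
by rewrite normrM ler_pM// ler_entry_mx_norm.
Qed.

Lemma Ck1_entry (V : normedModType R) k l (F : V -> 'M[R]_(k, l)) i j :
  Ck 1 F -> Ck 1 (fun x => F x i j).
Proof.
move=> [dF cF].
have dF' x : differentiable (fun y => F y i j) x.
  exact: (differentiable_comp (dF x) (differentiable_coord _ i j)).
split=> // v x.
have -> : (fun x : V => 'd (fun y => F y i j) x v) = (fun x => ('d F x v) i j).
  apply/funext => y; rewrite -!deriveE// derive_mx ?mxE//.
  exact: diff_derivable.
have := @continuous_comp V 'M[R]_(k, l) R (fun x => 'd F x v)
  (fun N => N i j) x (cF v x) (@coord_continuous R k l i j ('d F x v)).
exact.
Qed.

(** [Ck] gives continuity of the differential in each fixed direction. The finitely many basis
    directions are therefore bounded simultaneously near each point, and the mean value theorem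
    along a segment gives a local Lipschitz constant. *)
Lemma Ck1_lip_on_balls n (f : 'cV[R]_n -> R) : Ck 1 f -> lip_on_balls f.
Proof.
move=> [df cf]; apply: lip_on_balls_local => x.
pose e i := delta_mx i 0 : 'cV[R]_n.
pose L := \sum_i (`|'d f x (e i)| + 1).
have : \forall y \near x, forall i, `|'d f y (e i)| <= `|'d f x (e i)| + 1.
  apply: (@filter_forall _ _ _ _ (nbhs_filter x)) => i.
  have /cvgrPdist_le/(_ 1 ltr01) := cf (e i) x.
  apply: filterS => y xy; rewrite -[X in `|X| <= _](subrK ('d f x (e i))) addrC.
  by rewrite (le_trans (ler_normD _ _))// lerD2l distrC.
move=> /nbhs_ballP[r /= r0 xr]; exists L, (ball x r); split.
  exact: nbhsx_ballx.
move=> y w; rewrite -ball_normE /= => xy xw.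
pose c (t : R) : 'cV[R]_n := w + t *: (y - w).
have dc (t : R) : is_derive t 1 c (y - w).
  exact: is_derive_affine.
have dfc (t : R) : is_derive t 1 (f \o c) ('d f (c t) (y - w)).
  exact: is_derive_chain (df _) (dc t).
have cfc : {within `[0, 1], continuous (f \o c)}.
  apply: continuous_subspaceT => t; apply: differentiable_continuous.
  by apply/derivable1_diffP; case: (dfc t).
have [t t01] := MVT_segment ler01 (fun t _ => dfc t) cfc.
rewrite /= /c scale0r addr0 scale1r [w + (_ - _)]addrC subrK subr0 mulr1 => ->.
(* Balls are convex, so the whole segment from [w] to [y] lies where the partial derivatives are
   bounded. *)
have inb : ball x r (c t).
  rewrite -ball_normE /= /c.
  have -> : x - (w + t *: (y - w)) = (1 - t) *: (x - w) + t *: (x - y).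
    by rewrite scalerBl scale1r !scalerBr; apply/matrixP => i j; rewrite !mxE; ring.
  move: t01; rewrite in_itv /= => /andP[t0 t1].
  rewrite (le_lt_trans (ler_normD _ _))// !normrZ (ger0_norm t0) ger0_norm ?subr_ge0//.
  have /le_lt_trans -> // : (1 - t) * `|x - w| + t * `|x - y|
     <= (1 - t) * Num.max `|x - w| `|x - y| + t * Num.max `|x - w| `|x - y|.
    by rewrite lerD// ler_wpM2l ?subr_ge0// le_max lexx ?orbT.
  by rewrite -mulrDl subrK mul1r gt_max xw.
have -> : 'd f (c t) (y - w) = \sum_i (y - w) i 0 * 'd f (c t) (e i).
  rewrite {1}[y - w]matrix_sum_delta linear_sum; apply: eq_bigr => i _.
  by rewrite big_ord1 linearZ.
rewrite (le_trans (ler_norm_sum _ _ _))// mulr_suml ler_sum// => i _.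
by rewrite normrM mulrC ler_pM// ?xr// ler_entry_mx_norm.
Qed.

Lemma lip_on_balls_gradient n (H : 'cV[R]_n -> R) :
  Ck 2 H -> mx_lip_on_balls (gradient H).
Proof.
move=> [dH cH] i j; under eq_fun => x do rewrite mxE deriveE//.
exact: Ck1_lip_on_balls (cH _).
Qed.

Lemma lip_on_balls_locally_lipschitz_in_x n k (t0 T t : R)
    (f : R -> 'cV[R]_n -> 'cV[R]_k) :
  locally_lipschitz_in_x t0 T f -> t \in `[t0, T] -> mx_lip_on_balls (f t).
Proof.
move=> lf tI i j; apply: lip_on_balls_local => x.
have [L [U [xU fL]]] := lf x; exists L, U; split=> // y w Uy Uw.
apply: le_trans (fL t tI (y, w) (conj Uy Uw)) => /=.
by have := ler_entry_mx_norm (f t y - f t w) i j; rewrite !mxE.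
Qed.

End MatrixValued.

(** * Growth estimates on the unit interval *)

Lemma within_continuous_comp_continuous (T U V : topologicalType) (A : set T)
    (f : T -> U) (g : U -> V) :
  {within A, continuous f} -> continuous g ->
  {within A, continuous (fun t => g (f t))}.
Proof. by move=> cf cg t; apply: (cvg_comp _ _ (cf t)); exact: cg. Qed.

Section Curves.
Variables (R : realType) (n : nat).
Implicit Types (y dy : R -> 'cV[R]_n).

(** For the maximum norm the scalar mean value theorem, applied to each entry at its own
    intermediate point, yields the same constant [K]. *)
Lemma mean_value_inequality y dy (a b K : R) :
  a <= b -> {within `[a, b], continuous y} ->
  (forall t : R, t \in `]a, b[ -> is_derive t 1 y (dy t) /\ `|dy t| <= K) ->
  `|y b - y a| <= K * (b - a).
Proof.
rewrite le_eqVlt => /predU1P[->|ab] cy dyK; first by rewrite !subrr normr0 mulr0.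
have K0 : 0 <= K.
  have [_] : is_derive ((a + b) / 2) 1 y (dy ((a + b) / 2)) /\
      `|dy ((a + b) / 2)| <= K.
    by apply: dyK; rewrite in_itv /=; apply/andP; split; lra.
  exact: le_trans.
apply: mx_norm_le => [|i j]; first by rewrite mulr_ge0// subr_ge0 ltW.
have cyij : {within `[a, b], continuous (fun t => y t i j)}.
  apply: (within_continuous_comp_continuous (g := fun N : 'cV[R]_n => N i j) cy) => N.
  exact: coord_continuous.
have dyij t : t \in `]a, b[ -> is_derive t 1 (fun t => y t i j) (dy t i j).
  move=> /dyK[[dyt <-] _]; split; first by move/derivable_mxP: dyt; exact.
  by rewrite derive_mx// mxE.
have [c cab] := MVT ab dyij cyij.
have ba0 : 0 <= b - a by rewrite subr_ge0 ltW.
rewrite !mxE => ->; rewrite normrM (ger0_norm ba0) ler_wpM2r//.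
exact: le_trans (ler_entry_mx_norm _ _ _) (dyK c cab).2.
Qed.

Lemma within_continuous_le y (a b c : R) :
  c <= b -> {within `[a, b], continuous y} -> {within `[a, c], continuous y}.
Proof.
move=> cb; apply: continuous_subspaceW => t /=.
by rewrite !in_itv /= => /andP[-> /le_trans]; exact.
Qed.

(** A bootstrap for solutions: a field bounded only on balls controls the speed only while the curve
    is within distance 1 of its start. *)
Lemma speed_bound_until_exit y dy (K : R) :
  K < 1 -> {within `[0, 1], continuous y} ->
  (forall t : R, t \in `]0, 1[ -> is_derive t 1 y (dy t) /\
     (`|y t - y 0| < 1 -> `|dy t| <= K)) ->
  forall t : R, t \in `[0, 1] -> `|y t - y 0| < 1.
Proof.
move=> K1 cy dyK t1 t1I; rewrite ltNge; apply/negP => t1Z.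
(* The bound on the speed holds up to the first exit time inf Z, where it
   contradicts the exit. *)
pose Z := [set t | t \in `[0, 1] /\ 1 <= `|y t - y 0|].
have Z0 : Z !=set0 by exists t1.
have lZ : has_lbound Z by exists 0 => t [] /[!in_itv]/= /andP[].
have hZ : has_inf Z by [].
pose c := inf Z.
have c0 : 0 <= c by apply: lb_le_inf => // t [] /[!in_itv]/= /andP[].
have c1 : c <= 1.
  apply: le_trans (_ : t1 <= 1); first exact: ge_inf.
  by move: t1I; rewrite in_itv/= => /andP[].
have ltc t : 0 <= t -> t < c -> `|y t - y 0| < 1.
  move=> t0 tc; rewrite ltNge; apply/negP => Zt.
  have : c <= t.
    apply: ge_inf => //; split => //.
    by rewrite in_itv/= t0 (le_trans (ltW tc)).
  by rewrite leNgt tc.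
have yc : `|y c - y 0| < 1.
  have cyc := within_continuous_le c1 cy.
  have := @mean_value_inequality y dy 0 c K c0 cyc _.
  rewrite subr0 => /(_ _)/le_lt_trans -> //.
    move=> t /[!in_itv]/= /andP[t0 tc].
    have [|dt H] := dyK t; first by rewrite in_itv/= t0 (lt_le_trans tc).
    by split => //; apply: H; exact: ltc (ltW t0) tc.
  have [K0|K0] := leP 0 K; first by rewrite (le_lt_trans _ K1)// ler_piMr.
  by rewrite (le_lt_trans _ ltr01)// nmulr_rle0.
(* The strict inequality at [c] persists nearby in the unit interval, while points of [Z] come
   arbitrarily close to its infimum. *)
have : \forall t \near within `[0, 1] (nbhs c), `|y t - y 0| < 1.
  have cI : `[0, 1]%classic c by rewrite /= in_itv/= c0 c1.
  have cyc : y @ within `[0, 1] (nbhs c) --> y c by move/subspace_continuousP: cy; exact.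
  have cn : (fun t => `|y t - y 0|) @ within `[0, 1] (nbhs c) --> `|y c - y 0|.
    by apply: cvg_norm; apply: cvgB => //; exact: cvg_cst.
  exact: (cvgr_lt _ cn _ yc).
rewrite near_withinE => /nbhs_ballP[r /= r0 rc].
have [t [tI Zt] tcr] := inf_adherent r0 hZ.
have ct : c <= t by exact: ge_inf.
have : `|y t - y 0| < 1.
  apply: rc => //; rewrite -ball_normE /= distrC ger0_norm ?subr_ge0//.
  by rewrite ltrBlDl.
by rewrite ltNge Zt.
Qed.

(** Evaluating the mean value inequality at a maximum point of the norm gives
    [max <= |y 0| + max / 2]; on a unit interval with [K <= 1/2] this replaces the exponential
    bound. *)
Lemma gronwall_half y dy (K : R) :
  0 <= K <= 1 / 2 -> {within `[0, 1], continuous y} ->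
  (forall t : R, t \in `]0, 1[ -> is_derive t 1 y (dy t) /\ `|dy t| <= K * `|y t|) ->
  forall t : R, t \in `[0, 1] -> `|y t| <= 2 * `|y 0|.
Proof.
move=> /andP[K0 K2] cy dyK.
have cny : {within `[0, 1], continuous (fun t => `|y t|)}.
  by move=> t; apply: cvg_norm; exact: cy.
have [c cI cmax] := EVT_max ler01 cny.
have [c0 c1] : 0 <= c /\ c <= 1 by move: cI; rewrite in_itv/= => /andP[].
have : `|y c - y 0| <= (K * `|y c|) * (c - 0).
  apply: (mean_value_inequality (dy := dy)) => //; first exact: within_continuous_le cy.
  move=> t /[!in_itv]/= /andP[t0 tc].
  have [|dt H] := dyK t; first by rewrite in_itv/= t0 (lt_le_trans tc).
  split=> //; apply: le_trans H _; rewrite ler_wpM2l// cmax// in_itv/=.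
  by rewrite (ltW t0) (le_trans (ltW tc)).
rewrite subr0 => yc t /cmax yt; apply: le_trans yt _.
have : `|y c| <= `|y c - y 0| + `|y 0|.
  by rewrite -[X in `|X| <= _](subrK (y 0)) ler_normD.
have : K * `|y c| * c <= 1 / 2 * `|y c|.
  by rewrite -[leRHS]mulr1 ler_pM ?mulr_ge0// ler_wpM2r.
lra.
Qed.

End Curves.

(** * Port-Hamiltonian vector fields and their solutions *)

Lemma continuous_norm_bounded (R : realType) (V : normedModType R) (a b : R)
    (u : R -> V) :
  {within `[a, b], continuous u} ->
  exists2 U, 0 <= U & forall t, t \in `[a, b] -> `|u t| <= U.
Proof.
move=> cu; have [ab|ba] := leP a b; last first.
  by exists 0 => // t /[!in_itv]/= /andP[/le_trans H/H]; rewrite leNgt ba.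
have cnu : {within `[a, b], continuous (fun t => `|u t|)}.
  by move=> t; apply: cvg_norm; exact: cu.
by have [c cI cmax] := EVT_max ab cnu; exists `|u c|.
Qed.

(** Time enters only through the bounded input [u], so one constant serves all times. Both the
    vector field and the power of a pH-ODE have this form. *)
Lemma affine_family_lipschitz (R : realType) n k l (I : set R) (U rho : R)
    (u : R -> 'cV[R]_l) (A : 'cV[R]_n -> 'cV[R]_k)
    (B : 'cV[R]_n -> 'M[R]_(k, l)) :
  (forall t, I t -> `|u t| <= U) -> mx_lip_on_balls A -> mx_lip_on_balls B ->
  exists2 L, 0 <= L & forall t x y, I t -> `|x| <= rho -> `|y| <= rho ->
    `|(A x + B x *m u t) - (A y + B y *m u t)| <= L * `|x - y|.
Proof.
move=> uU lA lB; have [L L0 HL] := mx_lip_on_balls_norm rho lA.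
have [K K0 HK] := mx_lip_on_balls_norm rho lB.
exists (L + l%:R * (K * `|U|)) => [|t x y It xr yr].
  by rewrite addr_ge0// !mulr_ge0.
rewrite opprD addrACA -mulmxBl mulrDl (le_trans (ler_normD _ _))// lerD ?HL//.
rewrite (le_trans (mulmx_norm _ _))// -!mulrA ler_wpM2l//.
rewrite [_ * `|x - y|]mulrC mulrA ler_pM ?HK//.
exact: le_trans (uU _ It) (ler_norm _).
Qed.

Lemma affine_family_bounded (R : realType) n k l (I : set R) (U rho : R)
    (u : R -> 'cV[R]_l) (A : 'cV[R]_n -> 'cV[R]_k)
    (B : 'cV[R]_n -> 'M[R]_(k, l)) :
  (forall t, I t -> `|u t| <= U) -> mx_lip_on_balls A -> mx_lip_on_balls B ->
  exists2 M, 0 <= M & forall t x, I t -> `|x| <= rho ->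
    `|A x + B x *m u t| <= M.
Proof.
move=> uU lA lB.
have [L L0 HL] := affine_family_lipschitz `|rho| uU lA lB.
exists (L * `|rho| + (`|A 0| + l%:R * (`|B 0| * `|U|))) => [|t x It xr].
  by rewrite !addr_ge0// !mulr_ge0.
have xr' : `|x| <= `|rho| by rewrite (le_trans xr)// ler_norm.
rewrite -[X in `|X| <= _](subrK (A 0 + B 0 *m u t)) (le_trans (ler_normD _ _))//.
rewrite lerD//.
  apply: le_trans (HL t x 0 It xr' _) _; first by rewrite normr0.
  by rewrite subr0 ler_wpM2l.
rewrite (le_trans (ler_normD _ _))// lerD2l (le_trans (mulmx_norm _ _))//.
rewrite ler_wpM2l// ler_wpM2l// (le_trans (uU _ It))//.
exact: ler_norm.
Qed.

Section Dot.
Variables (R : realType) (n : nat).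
Implicit Types v w : 'cV[R]_n.

Lemma dotE v w : dot v w = \sum_i v i 0 * w i 0.
Proof. by rewrite /dot mxE; apply: eq_bigr => i _; rewrite mxE. Qed.

Lemma dotDr v w1 w2 : dot v (w1 + w2) = dot v w1 + dot v w2.
Proof. by rewrite /dot mulmxDr mxE. Qed.

Lemma dotBr v w1 w2 : dot v (w1 - w2) = dot v w1 - dot v w2.
Proof. by rewrite /dot mulmxBr !mxE. Qed.

Lemma dot_trmx k (A : 'M[R]_(n, k)) v (w : 'cV[R]_k) :
  dot (A^T *m v) w = dot v (A *m w).
Proof. by rewrite /dot trmx_mul trmxK mulmxA. Qed.

Lemma dotC v w : dot v w = dot w v.
Proof. by rewrite !dotE; apply: eq_bigr => i _; rewrite mulrC. Qed.

Lemma dot_skew (A : 'M[R]_n) v : A = - A^T -> dot v (A *m v) = 0.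
Proof.
move=> AT; have : dot v (A *m v) = - dot v (A *m v).
  rewrite {1}AT mulNmx {1}/dot mulmxN mxE -/(dot v (A^T *m v)).
  by rewrite dotC dot_trmx.
by move=> H; lra.
Qed.

Lemma continuous_dot (X : topologicalType) (f g : X -> 'cV[R]_n) :
  continuous f -> continuous g -> continuous (fun x => dot (f x) (g x)).
Proof.
move=> cf cg x; under eq_fun => t do rewrite dotE.
apply: cvg_big => [|i _]; first exact: add_continuous.
have coord (h : X -> 'cV[R]_n) : continuous h -> h t i 0 @[t --> x] --> h x i 0.
  move=> ch; exact: (cvg_comp h (fun N => N i 0) (ch x)
    (@coord_continuous R n 1 i 0 (h x))).
by apply: cvgM; exact: coord.
Qed.

End Dot.

Lemma mx_lip_on_balls_continuous (R : realType) (V : normedModType R) k l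
    (F : V -> 'M[R]_(k, l)) : mx_lip_on_balls F -> continuous F.
Proof.
move=> lF x; apply/(cvgrPdist_le (FF := nbhs_filter x)) => e e0.
have : \forall y \near x, forall ij, `|F x ij.1 ij.2 - F y ij.1 ij.2| <= e.
  apply: (@filter_forall _ _ _ _ (nbhs_filter x)) => -[i j] /=.
  have /cvgrPdist_le := lip_on_balls_continuous (lF i j) (x := x).
  exact.
apply: filterS => y xy; apply: mx_norm_le (ltW e0) _ => i j.
by have := xy (i, j); rewrite !mxE.
Qed.

Section PortHamiltonian.
Variables (R : realType) (n m : nat) (t0 T : R) (P : ph_data R n m).

Definition ph_drift (x : 'cV[R]_n) : 'cV[R]_n := (phJ P x - phR P x) *m phz P x.

(** The drift is required to be Lipschitz as a whole, not [J] and [R] separately: this is what the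
    regularity of the right-hand side and of [B] provides, and [dissipation_drift] expresses the
    dissipation through it. *)
Definition regular_pH : Prop :=
  [/\ is_pH P, {within `[t0, T], continuous (phu P)},
      mx_lip_on_balls ph_drift, mx_lip_on_balls (phB P)
    & mx_lip_on_balls (phz P) /\ mx_lip_on_balls (fun x => invmx (phE P x))].

Hypothesis pHP : is_pH P.

(** The skew part does no work. The regularity of the dissipation is inherited from the drift and
    [z] through this identity. *)
Lemma dissipation_drift x : dissipation P x = dot (phz P x) (ph_drift x).
Proof.
have [Jskew _ _ _ _] := pHP.
by rewrite /dissipation /ph_drift mulmxBl dotBr (dot_skew _ (Jskew x)) sub0r.
Qed.

Lemma power_balance t x :
  dissipation P x + supply P t x = dot (phz P x) (ph_rhs P t x).
Proof. by rewrite dissipation_drift /supply dot_trmx -dotDr. Qed.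

Lemma diff_hamiltonian x v :
  'd (phH P) x v = dot (phz P x) (phE P x *m v).
Proof.
have [_ _ _ dH Ez] := pHP; rewrite -dot_trmx Ez dotE {1}[v]matrix_sum_delta linear_sum.
apply: eq_bigr => i _.
by rewrite big_ord1 linearZ /= mxE deriveE// [LHS]mulrC.
Qed.

Definition ph_field (t : R) (x : 'cV[R]_n) := invmx (phE P x) *m ph_rhs P t x.

(** The chain rule combined with the power balance; [k] is the speed of a rescaled time, negative
    for backward substeps. *)
Lemma is_derive_hamiltonian (c : R -> 'cV[R]_n) (r t k : R) :
  is_derive r 1 c (k *: ph_field t (c r)) ->
  is_derive r 1 (phH P \o c)
    (k * (dissipation P (c r) + supply P t (c r))).
Proof.
have [_ _ uE dH _] := pHP => dc.
have := is_derive_chain (dH (c r)) dc; rewrite linearZ diff_hamiltonian.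
by rewrite /ph_field mulmxA mulmxV ?uE// mul1mx -power_balance.
Qed.

Lemma solution_field s t (x : R -> 'cV[R]_n) tau :
  solution_between P s t x -> tau \in `]Num.min s t, Num.max s t[ ->
  is_derive tau 1 x (ph_field tau (x tau)).
Proof.
move=> [_ +] tauI => /(_ _ tauI)[dx Ex]; have [_ _ uE _ _] := pHP.
by split=> //; rewrite /ph_field -Ex mulmxA mulVmx ?uE// mul1mx.
Qed.

End PortHamiltonian.

Section Solutions.
Variables (R : realType) (n m : nat) (t0 T : R) (P : ph_data R n m).

Lemma rescaled_time_in s t (theta : R) : s != t ->
  (theta \in `[0, 1] -> s + theta * (t - s) \in `[Num.min s t, Num.max s t]) /\
  (theta \in `]0, 1[ -> s + theta * (t - s) \in `]Num.min s t, Num.max s t[).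
Proof.
move=> st; rewrite !in_itv /=.
have [ts|ts|/eqP] := ltgtP s t; last by rewrite (negPf st).
  by split=> /andP[? ?]; apply/andP; split; nra.
by split=> /andP[? ?]; apply/andP; split; nra.
Qed.

(** The rescaling treats forward and backward substeps alike. *)
Lemma rescaled_solution s t x : is_pH P -> s != t -> solution_between P s t x ->
  let y theta := x (s + theta * (t - s)) in
  {within `[0, 1], continuous y} /\ forall theta : R, theta \in `]0, 1[ ->
    is_derive theta 1 y ((t - s) *: ph_field P (s + theta * (t - s)) (y theta)).
Proof.
move=> pHP st sol y.
have dl (theta : R) : is_derive theta 1 (fun r : R => s + r *: (t - s)) (t - s).
  exact: is_derive_affine.
split.
  apply/subspace_continuousP => theta thI.
  have [+ _] := sol.
  move=> /subspace_continuousP/(_ _ ((rescaled_time_in theta st).1 thI)).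
  move=> xl A /xl; rewrite /= /nbhs /= /within /= => HA.
  have cl : (fun r : R => s + r * (t - s)) @ theta --> s + theta * (t - s).
    have : {for theta, continuous (fun r : R => s + r *: (t - s))}.
      apply: differentiable_continuous; apply/derivable1_diffP.
      by have [] := dl theta.
    exact.
  have := cl _ HA; apply: (@filterS R _ (nbhs_filter (theta : R))) => r /= rA rI.
  apply: rA; exact: (rescaled_time_in r st).1.
move=> theta thI.
have [dx Dx] := solution_field pHP sol ((rescaled_time_in theta st).2 thI).
have := @is_derive_chain R R _ x (fun r : R => s + r *: (t - s)) theta (t - s) _
  (dl theta).
move=> /(_ ((derivable1_diffP _ _).1 dx)).
by rewrite -[X in 'd _ _ X]mulr1 -[_ * 1]/(_ *: 1) linearZ /= -deriveE ?Dx//;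
  apply/derivable1_diffP.
Qed.

(** The third estimate gains a factor [|t - s|]: the difference of the two energies has as its
    derivative a difference of powers, which is Lipschitz in the states, and it is integrated only
    over the length of the step. *)
Lemma solution_estimates (rho : R) : regular_pH t0 T P ->
  exists delta C, [/\ 0 < delta, 0 <= C &
  forall s t x w, s != t -> s \in `[t0, T] -> t \in `[t0, T] ->
    `|t - s| <= delta -> solution_between P s t x -> solution_between P s t w ->
    `|x s| <= rho -> `|w s| <= rho ->
    [/\ `|x t| <= rho + 1, `|x t - w t| <= 2 * `|x s - w s|
      & `|(phH P (x t) - phH P (x s)) - (phH P (w t) - phH P (w s))|
          <= C * (`|t - s| * `|x s - w s|)]].
Proof.
move=> [pHP cu lA lB [lz lE]].
have [U U0 uU] := continuous_norm_bounded cu.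
pose I := [set t | t \in `[t0, T]].
have uI t : I t -> `|phu P t| <= U by exact: uU.
have fieldE t x : ph_field P t x = invmx (phE P x) *m ph_drift P x +
    (invmx (phE P x) *m phB P x) *m phu P t.
  by rewrite /ph_field /ph_rhs /ph_drift mulmxDr !mulmxA.
have powerE t x : dissipation P x + supply P t x =
    ((phz P x)^T *m ph_drift P x + ((phz P x)^T *m phB P x) *m phu P t) 0 0.
  by rewrite (power_balance pHP) /ph_rhs /ph_drift /dot mulmxDr !mulmxA.
have lzT := mx_lip_on_ballsT lz.
have [M M0 HM] := affine_family_bounded (rho + 1) uI
  (mx_lip_on_ballsM lE lA) (mx_lip_on_ballsM lE lB).
have [L L0 HL] := affine_family_lipschitz (rho + 1) uI
  (mx_lip_on_ballsM lE lA) (mx_lip_on_ballsM lE lB).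
have [K K0 HK] := affine_family_lipschitz (rho + 1) uI
  (mx_lip_on_ballsM lzT lA) (mx_lip_on_ballsM lzT lB).
(* With this step size both [|k| * M] and [|k| * L] are at most 1/2, as needed for the confinement
   and for [gronwall_half]. The factor 2 in [2 * K] is the growth of the state difference. *)
exists (1 / (2 * (M + L + 1))), (2 * K); split; [|exact: mulr_ge0|].
  by rewrite divr_gt0// mulr_gt0// ltr_wpDl// addr_ge0.
move=> s t x w st sI tI ts solx solw xr wr.
have tauI (theta : R) : theta \in `[0, 1] -> s + theta * (t - s) \in `[t0, T].
  move: sI tI; rewrite !in_itv/= => /andP[? ?] /andP[? ?] /andP[? ?].
  by apply/andP; split; nra.
have ooI (theta : R) : theta \in `]0, 1[ -> theta \in `[0, 1].
  by rewrite !in_itv/= => /andP[/ltW -> /ltW ->].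
set k := t - s in ts tauI *.
have kML : `|k| * (M + L + 1) <= 1 / 2.
  rewrite -ler_pdivlMr ?ltr_wpDl ?addr_ge0//; apply: le_trans ts _.
  by rewrite -!mulrA !mul1r invfM.
have kM : `|k| * M <= 1 / 2.
  by apply: le_trans kML; rewrite ler_wpM2l// -addrA lerDl addr_ge0.
have kL : `|k| * L <= 1 / 2.
  by apply: le_trans kML; rewrite ler_wpM2l// addrAC lerDr addr_ge0.
(* Confinement to the ball of radius [rho + 1], on which the constants [M], [L] and [K] were
   chosen. *)
have stay z : solution_between P s t z -> `|z s| <= rho ->
    forall theta, theta \in `[0, 1] -> `|z (s + theta * k)| <= rho + 1.
  move=> solz zr; have [cy dy] := rescaled_solution pHP st solz.
  have nearby (theta : R) :
      `|z (s + theta * k) - z s| < 1 -> `|z (s + theta * k)| <= rho + 1.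
    move=> H; rewrite -[z (_ + _)](subrK (z s)) addrC (le_trans (ler_normD _ _))//.
    by rewrite lerD// ltW.
  move=> theta /(@speed_bound_until_exit _ _ _ _ (1/2) _ cy).
  move=> /(_ (fun r => k *: ph_field P (s + r * k) (z (s + r * k)))) H.
  apply: (nearby theta); move: H; rewrite mul0r addr0; apply; first by lra.
  move=> r rI; split; first exact: dy.
  move=> zr1; rewrite normrZ; apply: le_trans kM; rewrite ler_wpM2l// fieldE.
  by apply: HM; [exact: tauI (ooI _ rI)|exact: nearby].
have [cx dx] := rescaled_solution pHP st solx.
have [cw dw] := rescaled_solution pHP st solw.
have xt : x t = x (s + 1 * k) by rewrite mul1r /k addrC subrK.
have wt : w t = w (s + 1 * k) by rewrite mul1r /k addrC subrK.
have I1 : (1 : R) \in `[0, 1] by rewrite in_itv/= ler01 lexx.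
pose e theta := x (s + theta * k) - w (s + theta * k).
have esmall (theta : R) : theta \in `[0, 1] -> `|e theta| <= 2 * `|x s - w s|.
  have ce : {within `[0, 1], continuous e}.
    by move=> r; apply: cvgB; [exact: cx|exact: cw].
  have -> : x s - w s = e 0 by rewrite /e mul0r addr0.
  apply: (@gronwall_half _ _ e (fun r => k *: ph_field P (s + r * k) (x (s + r * k))
    - k *: ph_field P (s + r * k) (w (s + r * k))) (`|k| * L)) => //.
    by rewrite mulr_ge0.
  move=> r rI; split; first by apply: is_deriveB; [exact: dx|exact: dw].
  rewrite -scalerBr normrZ -mulrA ler_wpM2l// !fieldE.
  by apply: HL; [exact: tauI (ooI _ rI)|exact: stay (ooI _ rI)..].
split; first by rewrite xt; exact: stay.
  by rewrite xt wt; exact: esmall.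
(* The double difference of energies is the increment of [f] over the unit interval, so the mean
   value theorem reduces it to one difference of powers. *)
pose f theta := phH P (x (s + theta * k)) - phH P (w (s + theta * k)).
have [_ _ _ dH _] := pHP.
have cH : continuous (phH P) by move=> z; exact: differentiable_continuous.
have cf : {within `[0, 1], continuous f}.
  move=> r; apply: cvgB.
    exact: (within_continuous_comp_continuous cx cH).
  exact: (within_continuous_comp_continuous cw cH).
have df (theta : R) : theta \in `]0, 1[ -> is_derive theta 1 f
    (k * (dissipation P (x (s + theta * k)) +
          supply P (s + theta * k) (x (s + theta * k))) -
     k * (dissipation P (w (s + theta * k)) +
          supply P (s + theta * k) (w (s + theta * k)))).
  move=> thI; apply: is_deriveB.
    exact: (is_derive_hamiltonian pHP (dx _ thI)).
  exact: (is_derive_hamiltonian pHP (dw _ thI)).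
have [c cI] := MVT ltr01 df cf.
have -> : (phH P (x t) - phH P (x s)) - (phH P (w t) - phH P (w s)) = f 1 - f 0.
  by rewrite /f -xt -wt mul0r addr0; ring.
move=> ->; rewrite subr0 mulr1 -mulrBr normrM [leRHS]mulrCA ler_wpM2l//.
rewrite [2 * K]mulrC -mulrA (@le_trans _ _ (K * `|e c|))//; last first.
  by rewrite ler_wpM2l// esmall// ooI.
have entry (F G : 'M[R]_1) : `|F 0 0 - G 0 0| <= `|F - G|.
  by have := ler_entry_mx_norm (F - G) 0 0; rewrite !mxE.
rewrite !powerE; apply: le_trans (entry _ _) _.
by apply: HK; [exact: tauI (ooI _ cI)|exact: stay (ooI _ cI)..].
Qed.

End Solutions.

(** * Energy balance and local errors *)

(** The fundamental theorem of calculus for [H] along the solution, whose derivative is the power;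
    continuity of the two terms allows the integral to be split. *)
Lemma energy_balance_ordered (R : realType) n m (t0 T : R) (P : ph_data R n m)
    (a b : R) (x : R -> 'cV[R]_n) :
  regular_pH t0 T P -> a < b -> a \in `[t0, T] -> b \in `[t0, T] ->
  {within `[a, b], continuous x} ->
  (forall tau, tau \in `]a, b[ -> is_derive tau 1 x (ph_field P tau (x tau))) ->
  \int[lebesgue_measure]_(tau in `[a, b]) dissipation P (x tau) +
  \int[lebesgue_measure]_(tau in `[a, b]) supply P tau (x tau) =
  phH P (x b) - phH P (x a).
Proof.
move=> regP ab aI bI cx dx.
have [pHP cu lA lB [lz _]] := regP; have [_ _ _ dH _] := pHP.
have cu' : {within `[a, b], continuous (phu P)}.
  apply: continuous_subspaceW cu => t /=; move: aI bI; rewrite !in_itv/=.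
  by move=> /andP[ta _] /andP[_ bT] /andP[/(le_trans ta) -> /le_trans->].
have cdiss : {within `[a, b], continuous (fun tau => dissipation P (x tau))}.
  have -> : (fun tau => dissipation P (x tau)) =
      (fun tau => dot (phz P (x tau)) (ph_drift P (x tau))).
    by apply/funext => tau; exact: (dissipation_drift pHP).
  apply: (@continuous_dot R n (subspace `[a, b])).
    exact: within_continuous_comp_continuous cx (mx_lip_on_balls_continuous lz).
  exact: within_continuous_comp_continuous cx (mx_lip_on_balls_continuous lA).
have csupp : {within `[a, b], continuous (fun tau => supply P tau (x tau))}.
  apply: (@continuous_dot R m (subspace `[a, b])); last exact: cu'.
  apply: (within_continuous_comp_continuous cx).
  apply: mx_lip_on_balls_continuous.
  exact: mx_lip_on_ballsM (mx_lip_on_ballsT lB) lz.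
have integrable_ab f : {within `[a, b], continuous f} ->
    lebesgue_measure.-integrable `[a, b] (EFin \o f).
  by apply: continuous_compact_integrable; exact: segment_compact.
rewrite -RintegralD//; [|exact: integrable_ab..].
have cH : {within `[a, b], continuous (phH P \o x)}.
  apply: (within_continuous_comp_continuous cx) => z.
  exact: differentiable_continuous.
have dHx tau : tau \in `]a, b[ -> is_derive tau 1 (phH P \o x)
    (dissipation P (x tau) + supply P tau (x tau)).
  move=> tauI; rewrite -[X in is_derive _ _ _ X]mul1r.
  by apply: (is_derive_hamiltonian pHP); rewrite scale1r; exact: dx.
rewrite /Rintegral (continuous_FTC2 (F := phH P \o x) ab)//.
- by move=> t; apply: cvgD; [exact: cdiss|exact: csupp].
- have [_ ca cb] := (continuous_within_itvP _ ab).1 cH.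
  by split=> // tau /dHx[].
- by move=> tau /dHx[_ <-]; rewrite derive1E.
Qed.

Lemma energy_balance (R : realType) n m (t0 T : R) (P : ph_data R n m)
    (s t : R) (x : R -> 'cV[R]_n) :
  regular_pH t0 T P -> s != t -> s \in `[t0, T] -> t \in `[t0, T] ->
  solution_between P s t x ->
  oriented_integral (fun tau => dissipation P (x tau)) s t +
  oriented_integral (fun tau => supply P tau (x tau)) s t =
  phH P (x t) - phH P (x s).
Proof.
move=> regP st sI tI sol; have [pHP _ _ _ _] := regP.
have dx tau := solution_field pHP sol (tau := tau).
have [cx _] := sol; rewrite /oriented_integral.
move: cx dx; have [lts|lts|/eqP] := ltgtP s t; last by rewrite (negPf st).
  move=> cx dx; exact: (energy_balance_ordered regP lts).
move=> cx dx; rewrite -opprD (energy_balance_ordered regP lts)//.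
by rewrite opprB.
Qed.

Section ExactFlow.
Variables (R : realType) (n m : nat) (t0 T : R) (P : ph_data R n m).

(** The flow is a choice among reachable endpoints, so a solution ending there is what its value
    provides. *)
Lemma exact_flow_solution t s xi eta : exact_flow t0 T P t s xi = Some eta ->
  exists x, [/\ solution_between P s t x, x s = xi & x t = eta].
Proof.
rewrite /exact_flow; case: xgetP => //= _ -> [eta' [_ [_ [x solx]]] <-] [<-].
by exists x.
Qed.

(** For equal times the only reachable endpoint is [xi]; the constant curve reaches it because the
    equation is imposed on an empty open interval. *)
Lemma exact_flow_refl s xi : s \in `[t0, T] ->
  exact_flow t0 T P s s xi = Some xi.
Proof.
move=> sI; rewrite /exact_flow; case: xgetP => [_ -> [eta' [_ [_ [x [_ xs xt]]]] <-]|].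
  by rewrite -xt xs.
move=> /(_ (Some xi))[]; exists xi => //; split=> //; split=> //.
exists (fun=> xi); split=> //; split.
  by move=> t; exact: cvg_cst.
by move=> tau; rewrite minxx maxxx in_itv/= => /andP[/lt_trans H/H]; rewrite ltxx.
Qed.

End ExactFlow.

(** The two flows start from different states, as they do inside a composition. States may drift
    apart by [h ^+ 2] per substep, and the factor [h] in front of [|xi - eta|] weakens the effect of
    this on the energy increments. The enlarged radius [rho + 2] is harmless for a fixed number of
    substeps. *)
Definition close_substeps (R : realType) n s (t0 T : R) (H : 'cV[R]_n -> R)
    (q : nat) (c : 'I_s -> R) (phi psi : flow_map R n) : Prop :=
  forall rho j, exists delta C, [/\ 0 < delta, 0 <= C & forall sg h xi eta,
    0 < h -> h <= delta -> sg \in `[t0, T] -> sg + h * c j \in `[t0, T] ->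
    `|xi| <= rho -> `|eta| <= rho -> exists xi' eta',
    [/\ phi (sg + h * c j) sg xi = Some xi',
        psi (sg + h * c j) sg eta = Some eta',
        `|xi'| <= rho + 2 /\ `|eta'| <= rho + 2,
        `|xi' - eta'| <= C * (`|xi - eta| + h ^+ 2)
      & `|(H eta' - H eta) - (H xi' - H xi)|
          <= C * (h * `|xi - eta| + h ^+ q.+1)]].

(** For the states, first-order consistency of [psi] is combined with the stability of exact
    solutions. For the energies, the increment of [psi] is compared with that of an exact solution
    from the same state [eta], and this with that of an exact solution from [xi]. *)
Lemma substep_estimates (R : realType) n m s (t0 T : R) (P : ph_data R n m)
    (c : 'I_s -> R) (psi : flow_map R n) (q q' : nat) :
  regular_pH t0 T P -> numerical_flow t0 T P (substep t0 T c) psi ->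
  energy_consistent_of_order P (substep t0 T c) psi q' -> (q <= q')%N ->
  close_substeps t0 T (phH P) q c (exact_flow t0 T P) psi.
Proof.
move=> regP [psi0 cons] [D [S [[dec _] ener]]] qq' rho j.
(* [substep] excludes zero step sizes, so a vanishing coefficient is treated apart: both flows are
   then the identity. *)
have [cj0|cj0] := eqVneq (c j) 0.
  exists 1, 1; split=> // sg h xi eta h0 h1 sgI _ xr er; exists xi, eta.
  rewrite cj0 mulr0 addr0 exact_flow_refl// psi0// !mul1r !subrr normr0.
  have r2 : rho <= rho + 2 by rewrite lerDl.
  split=> //; first by split; exact: le_trans r2.
    by rewrite lerDl exprn_ge0// ltW.
  by rewrite addr_ge0 ?mulr_ge0 ?exprn_ge0// ltW.
have [C1 [d1 [d10 H1]]] := cons rho; have [C2 [d2 [d20 H2]]] := ener rho.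
have [d3 [C3 [d30 C30 H3]]] := solution_estimates rho regP.
pose k := `|c j|; have k0 : 0 < k by rewrite normr_gt0.
have k0' : 0 <= k by exact: ltW.
pose e := `|C1| * k ^+ 2; have e0 : 0 <= e by rewrite mulr_ge0// exprn_ge0.
(* The bound [1 / (e + 1)] keeps the consistency error [e * h ^+ 2] below 1; dividing by [k] makes
   the actual step size [h * c j] admissible. *)
exists (Num.min (Num.min 1 (1 / (e + 1))) (Num.min d1 (Num.min d2 d3) / k)).
have kq0 r : 0 <= k ^+ r by rewrite exprn_ge0.
pose e2 := 2 * (`|C2| * k ^+ q'.+1).
have e20 : 0 <= e2 by rewrite !mulr_ge0// exprn_ge0.
have C3k0 : 0 <= C3 * k by exact: mulr_ge0.
(* The summands account, in turn, for the growth of the state difference, the consistency error, the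
   errors of [D] and [S], and the perturbation of the exact energy increment. *)
pose C := 2 + e + e2 + C3 * k; exists C.
have [CC2 CCe CCe2] : [/\ 2 <= C, e <= C & e2 + C3 * k <= C].
  by rewrite /C; clear -e0 e20 C3k0; split; lra.
have C0 : 0 <= C by exact: le_trans CC2.
split=> //.
  rewrite !lt_min ltr01 !divr_gt0 ?lt_min ?d10 ?d20 ?d30//.
  by rewrite ltr_wpDl.
move=> sg h xi eta h0; have h0' : 0 <= h by exact: ltW.
rewrite !le_min => /andP[/andP[h1 he]].
rewrite ler_pdivlMr// !le_min => /and3P[hd1 hd2 hd3] sgI tI xr er.
have nk : `|h * c j| = h * k by rewrite normrM gtr0_norm.
have stp : substep t0 T c sg (h * c j).
  by split=> //; [rewrite mulf_neq0// gt_eqF|exists j, h].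
have stk : sg + h * c j - sg = h * c j by rewrite addrAC subrr add0r.
have st : sg != sg + h * c j.
  by rewrite -subr_eq0 -opprB stk oppr_eq0; case: stp.
have [||_ [xi' [_ fxi _]]] := H1 sg (h * c j) xi stp; rewrite ?nk//.
have [||eta' [eta'' [peta feta etaC]]] := H1 sg (h * c j) eta stp; rewrite ?nk//.
have [||eta1 [x [peta1 [solx x0] HD HS]]] := H2 sg (h * c j) eta stp; rewrite ?nk//.
move: peta1; rewrite peta => -[?]; subst eta1.
have [energy _ _ _] := dec _ _ _ _ stp peta.
(* v and x both start in eta; their uniqueness is not needed, as each is
   compared with w. *)
have [w [solw w0 wt]] := exact_flow_solution fxi.
have [v [solv v0 vt]] := exact_flow_solution feta.
have small : `|sg + h * c j - sg| <= d3 by rewrite stk nk.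
have [wr _ Hxw] := H3 _ _ _ _ st sgI tI small solw solx
  (eq_ind_r (fun y => `|y| <= rho) xr w0) (eq_ind_r (fun y => `|y| <= rho) er x0).
have [_ Hwv _] := H3 _ _ _ _ st sgI tI small solw solv
  (eq_ind_r (fun y => `|y| <= rho) xr w0) (eq_ind_r (fun y => `|y| <= rho) er v0).
have [vr _ _] := H3 _ _ _ _ st sgI tI small solv solv
  (eq_ind_r (fun y => `|y| <= rho) er v0) (eq_ind_r (fun y => `|y| <= rho) er v0).
have bal := energy_balance regP st sgI tI solx.
rewrite {}w0 {}v0 {}x0 {}wt {}vt stk nk in wr Hxw Hwv vr bal etaC HD HS.
have h2 : h ^+ 2 <= h by rewrite expr2 ler_piMl// ltW.
have C1h : C1 * (h * k) ^+ 2 <= e * h ^+ 2.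
  rewrite (_ : C1 * _ = C1 * k ^+ 2 * h ^+ 2); last by ring.
  by rewrite ler_wpM2r ?exprn_ge0// ler_wpM2r// ler_norm.
have etaC1 : `|eta' - eta''| <= 1.
  apply: le_trans etaC _; apply: le_trans C1h _.
  apply: (@le_trans _ _ ((e + 1) * h)).
    by rewrite ler_pM// ?exprn_ge0 ?(ltW h0)// lerDl.
  by rewrite mulrC -ler_pdivlMr// ltr_wpDl.
exists xi', eta'; split=> //.
- split; first by clear -wr; lra.
  have := ler_normD (eta' - eta'') eta''; rewrite subrK; clear -vr etaC1; lra.
- have -> : xi' - eta' = (xi' - eta'') - (eta' - eta'') by rewrite opprB addrA subrK.
  rewrite (le_trans (ler_normB _ _))// mulrDr lerD//.
    by apply: le_trans Hwv _; rewrite ler_wpM2r.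
  apply: le_trans etaC _; apply: le_trans C1h _.
  by rewrite ler_wpM2r// exprn_ge0.
set dD := D _ _ _ - _ in HD; set dS := S _ _ _ - _ in HS.
(* [dD + dS] is the error of the scheme against the integrals along [x], whose sum is the increment
   of [H] along [x]; the rest compares the exact increments along [w] and [x]. *)
have -> : (phH P eta' - phH P eta) - (phH P xi' - phH P xi) =
    dD + dS - ((phH P xi' - phH P xi) - (phH P (x (sg + h * c j)) - phH P eta)).
  by rewrite energy -bal /dD /dS; ring.
have hq : h ^+ q'.+1 <= h ^+ q.+1 by apply: ler_wiXn2l => //; rewrite ?ltW.
have C2h : C2 * (h * k) ^+ q'.+1 <= `|C2| * k ^+ q'.+1 * h ^+ q.+1.
  rewrite exprMn (_ : C2 * _ = C2 * k ^+ q'.+1 * h ^+ q'.+1); last by ring.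
  apply: (@le_trans _ _ (`|C2| * k ^+ q'.+1 * h ^+ q'.+1)).
    by rewrite ler_wpM2r ?exprn_ge0// ler_wpM2r// ler_norm.
  by rewrite ler_wpM2l// mulr_ge0.
apply: le_trans (ler_normB _ _) _; apply: le_trans (lerD (ler_normD _ _) (lexx _)) _.
apply: le_trans (lerD (lerD HD HS) Hxw) _.
apply: (@le_trans _ _ (e2 * h ^+ q.+1 + C3 * k * (h * `|xi - eta|))).
  rewrite lerD//; last by rewrite -!mulrA [k * (h * _)]mulrCA.
  by rewrite -[e2]/(2 * _) -mulrA mulrDl mul1r lerD.
rewrite [leRHS]mulrDr addrC lerD// ler_wpM2r ?mulr_ge0 ?exprn_ge0//.
  by clear -CCe2 e20; lra.
by clear -CCe2 C3k0; lra.
Qed.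

(** * Composition of the substeps *)

Section SplittingPrefix.
Variables (R : realType) (n s : nat) (t0 T : R) (a b : 'I_s -> R).
Implicit Types (phi psi : flow_map R n).

(** The first [k] stages, still with the times of the full step [h], so that inductions can run over
    the stages. *)
Definition splitting_prefix phi1 phi2 (k : nat) (sg h : R) (xi : 'cV[R]_n) :=
  foldl (fun x k =>
      obind (phi2 (sg + h * partial_sum b k.+1) (sg + h * partial_sum b k))
        (obind (phi1 (sg + h * partial_sum a k.+1) (sg + h * partial_sum a k)) x))
    (Some xi) (iota 0 k).

Lemma splitting_methodE phi1 phi2 sg h xi :
  splitting_method a b phi1 phi2 (sg + h) sg xi =
  splitting_prefix phi1 phi2 s sg h xi.
Proof. by rewrite /splitting_method addrAC subrr add0r. Qed.

Lemma partial_sumS (c : 'I_s -> R) (j : 'I_s) :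
  partial_sum c j.+1 = partial_sum c j + c j.
Proof.
rewrite /partial_sum (bigD1 j) ?ltnSn//= addrC; congr (_ + _).
by apply: eq_bigl => l; rewrite ltnS [RHS]ltn_neqAle andbC.
Qed.

Lemma splitting_prefixS phi1 phi2 (j : 'I_s) sg h xi :
  splitting_prefix phi1 phi2 j.+1 sg h xi =
  obind (phi2 (sg + h * partial_sum b j + h * b j) (sg + h * partial_sum b j))
    (obind (phi1 (sg + h * partial_sum a j + h * a j) (sg + h * partial_sum a j))
      (splitting_prefix phi1 phi2 j sg h xi)).
Proof.
rewrite /splitting_prefix -[in iota 0 j.+1]addn1 iotaD foldl_cat /= add0n !partial_sumS.
by rewrite !mulrDr !addrA.
Qed.

Lemma splitting_step_times (j : 'I_s) sg h : splitting_step t0 T a b sg h ->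
  [/\ sg + h * partial_sum a j \in `[t0, T],
      sg + h * partial_sum a j + h * a j \in `[t0, T],
      sg + h * partial_sum b j \in `[t0, T]
    & sg + h * partial_sum b j + h * b j \in `[t0, T]].
Proof.
move=> [_ _ _ times]; rewrite -!addrA -!mulrDr -!partial_sumS.
have [? ?] := times j (ltnW (ltn_ord j)).
by have [? ?] := times j.+1 (ltn_ord j).
Qed.

(** Serves to carry decrease and conservation of the energy from the substeps to the whole step. *)
Lemma splitting_prefix_invariant (Q : 'cV[R]_n -> Prop) psi1 psi2 sg h :
  let preserved (psi : flow_map R n) (c : 'I_s -> R) :=
    forall (j : 'I_s) tau x x', tau \in `[t0, T] -> tau + h * c j \in `[t0, T] ->
      psi (tau + h * c j) tau x = Some x' -> Q x -> Q x' in
  splitting_step t0 T a b sg h -> preserved psi1 a -> preserved psi2 b ->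
  forall k xi x, (k <= s)%N -> splitting_prefix psi1 psi2 k sg h xi = Some x ->
    Q xi -> Q x.
Proof.
move=> preserved stp pres1 pres2; elim=> [|k IH] xi x ks; first by move=> [<-].
rewrite (splitting_prefixS _ _ (Ordinal ks)) /=.
have [ta ta' tb tb'] := splitting_step_times (Ordinal ks) stp.
case E : (splitting_prefix _ _ k sg h xi) => [y|//] /=.
case Ea : (psi1 _ _ y) => [y'|//] /= Eb /(IH _ _ (ltnW ks) E) Qy.
exact: pres2 tb tb' Eb (pres1 _ _ _ _ ta ta' Ea Qy).
Qed.

Variables (H : 'cV[R]_n -> R) (q : nat).

(** The accumulated form of [close_substeps]: with a common initial state, the energies themselves
    can be compared. *)
Definition close_maps (F G : R -> R -> 'cV[R]_n -> option 'cV[R]_n) : Prop :=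
  forall rho, exists delta C rho', [/\ 0 < delta, 0 <= C & forall sg h xi,
    splitting_step t0 T a b sg h -> h <= delta -> `|xi| <= rho ->
    exists x y, [/\ F sg h xi = Some x, G sg h xi = Some y,
      `|x| <= rho' /\ `|y| <= rho', `|x - y| <= C * h ^+ 2
      & `|H y - H x| <= C * h ^+ q.+1]].

Lemma close_maps_substep F G phi psi (c : 'I_s -> R) (j : 'I_s)
    (tau : R -> R -> R) :
  (q <= 2)%N -> close_maps F G -> close_substeps t0 T H q c phi psi ->
  (forall sg h, splitting_step t0 T a b sg h ->
     tau sg h \in `[t0, T] /\ tau sg h + h * c j \in `[t0, T]) ->
  close_maps (fun sg h xi => obind (phi (tau sg h + h * c j) (tau sg h)) (F sg h xi))
             (fun sg h xi => obind (psi (tau sg h + h * c j) (tau sg h)) (G sg h xi)).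
Proof.
move=> q2 clFG cl times rho.
have [d1 [C1 [r1 [d10 C10 H1]]]] := clFG rho.
have [d2 [C2 [d20 C20 H2]]] := cl r1 j.
exists (Num.min 1 (Num.min d1 d2)), (C1 + C2 * (C1 + 1)), (r1 + 2).
have C3 : 0 <= C2 * (C1 + 1) by rewrite mulr_ge0// addr_ge0.
split; [by rewrite !lt_min ltr01 d10|exact: addr_ge0|].
move=> sg h xi stp; rewrite !le_min => /and3P[h1 hd1 hd2] xr.
have h0 : 0 < h by case: stp.
have [x [y [Fx Gy [xr1 yr1] xy Hxy]]] := H1 _ _ _ stp hd1 xr.
have [t1 t2] := times _ _ stp.
have [x' [y' [phix psiy bd xy' Hxy']]] := H2 _ _ x y h0 hd2 t1 t2 xr1 yr1.
exists x', y'; rewrite Fx Gy /= phix psiy; split=> //.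
  apply: le_trans xy' _; rewrite mulrDl -[leLHS]add0r lerD//.
    by rewrite mulr_ge0// exprn_ge0// ltW.
  by rewrite -mulrA ler_wpM2l// mulrDl mul1r lerD2r.
(* Here [q <= 2] is decisive: the accumulated state error affects the energy increment of the next
   substep by a term of order [h ^+ 3]. *)
have hq : h * (C1 * h ^+ 2) <= C1 * h ^+ q.+1.
  rewrite mulrCA ler_wpM2l// -exprS.
  by apply: ler_wiXn2l => //; exact: ltW.
have -> : H y' - H x' = (H y - H x) + ((H y' - H y) - (H x' - H x)) by ring.
rewrite (le_trans (ler_normD _ _))// mulrDl lerD//.
apply: le_trans Hxy' _; rewrite -mulrA ler_wpM2l// mulrDl mul1r lerD2r.
by apply: le_trans hq; rewrite ler_wpM2l// ltW.
Qed.

Lemma close_splitting_prefix phi1 phi2 psi1 psi2 k :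
  (q <= 2)%N -> (k <= s)%N ->
  close_substeps t0 T H q a phi1 psi1 -> close_substeps t0 T H q b phi2 psi2 ->
  close_maps (splitting_prefix phi1 phi2 k) (splitting_prefix psi1 psi2 k).
Proof.
move=> q2 + cl1 cl2; elim: k => [_|k IH ks].
  move=> rho; exists 1, 0, rho; split=> // sg h xi _ _ xr; exists xi, xi.
  by rewrite !subrr !normr0 !mul0r.
pose j := Ordinal ks.
have cla := @close_maps_substep _ _ _ _ a j (fun sg h => sg + h * partial_sum a j)
  q2 (IH (ltnW ks)) cl1.
have clb := @close_maps_substep _ _ _ _ b j (fun sg h => sg + h * partial_sum b j)
  q2 (cla _) cl2.
have prefixS phi1' phi2' : splitting_prefix phi1' phi2' k.+1 = (fun sg h xi =>
    obind (phi2' (sg + h * partial_sum b j + h * b j) (sg + h * partial_sum b j))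
    (obind (phi1' (sg + h * partial_sum a j + h * a j) (sg + h * partial_sum a j))
      (splitting_prefix phi1' phi2' j sg h xi))).
  apply/funext => sg; apply/funext => h; apply/funext => xi.
  exact: (splitting_prefixS _ _ j).
rewrite !prefixS.
by apply: clb => [sg h /(splitting_step_times j)[]|sg h /(splitting_step_times j)[]].
Qed.

End SplittingPrefix.

(** * Regularity and energy decay of the subproblems, and the decomposition for the full method *)

(** Two nonnegative quadratic forms with sum 0 vanish, and polarization then kills the symmetric
    matrix. This turns [R = 0] into [R1 = R2 = 0]. *)
Lemma psd_add_eq0 (R : realType) n (A B : 'M[R]_n) :
  psd A -> psd B -> A + B = 0 -> A = 0.
Proof.
move=> [AT A0] [_ B0] AB0.
have quad v : dot v (A *m v) = 0.
  apply/eqP; rewrite eq_le A0 andbT.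
  have : dot v (A *m v) + dot v (B *m v) = 0.
    by rewrite -dotDr -mulmxDl AB0 mul0mx dotE big1// => i _; rewrite mxE mulr0.
  by have := B0 v; lra.
have bilin v w : dot v (A *m w) = 0.
  have sym : dot w (A *m v) = dot v (A *m w) by rewrite -dot_trmx AT dotC.
  have := quad (v + w); rewrite mulmxDr dotDr dotC dotDr [X in _ + X]dotC dotDr.
  rewrite ![dot (A *m _) _]dotC !quad sym; lra.
apply/matrixP => i j; rewrite mxE; have := bilin (delta_mx i 0) (delta_mx j 0).
by rewrite /dot trmx_delta -colE -rowE !mxE.
Qed.

Lemma CkS (R : realType) (V W : normedModType R) k (f : V -> W) :
  Ck k.+1 f -> Ck k f.
Proof.
elim: k f => [|k IH] f [df cf]; first by move=> x; exact: differentiable_continuous.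
by split=> // v; exact: IH.
Qed.

Lemma Ck_le (R : realType) (V W : normedModType R) k l (f : V -> W) :
  (k <= l)%N -> Ck l f -> Ck k f.
Proof.
move=> /subnK <-; elim: (l - k)%N => // d IH; rewrite addSn => /CkS.
exact: IH.
Qed.

Lemma Ck1_mx_lip_on_balls (R : realType) n k l (F : 'cV[R]_n -> 'M[R]_(k, l)) :
  Ck 1 F -> mx_lip_on_balls F.
Proof. by move=> cF i j; apply: Ck1_lip_on_balls; exact: Ck1_entry. Qed.

Lemma Ck_on_within_continuous (R : realType) (V W : normedModType R) k A
    (f : V -> W) : Ck_on k A f -> {within A, continuous f}.
Proof.
move=> [g cg fg]; have cg0 : {within A, continuous g}.
  by apply: continuous_subspaceT; exact: (Ck_le (leq0n k) cg).
apply: subspace_eq_continuous cg0 => x.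
by rewrite inE => Ax; exact: esym (fg _ Ax).
Qed.

(** The drift is recovered from the right-hand side at the fixed time [t0] by subtracting
    [B(x) u(t0)], and [z] from the gradient of [H] by applying the inverse transpose of [E]. *)
Lemma smooth_regular_pH (R : realType) n m (t0 T : R) (P : ph_data R n m) k :
  t0 < T -> is_pH P -> locally_lipschitz_in_x t0 T (ph_rhs P) ->
  Ck 1 (phB P) -> Ck 1 (phE P) -> Ck 2 (phH P) -> Ck_on k `[t0, T] (phu P) ->
  regular_pH t0 T P.
Proof.
move=> tT pH lf cB cE cH cu; have lB := Ck1_mx_lip_on_balls cB.
have [_ _ uE _ Ez] := pH.
have lE : mx_lip_on_balls (fun x => invmx (phE P x)).
  exact: mx_lip_on_ballsV (Ck1_mx_lip_on_balls cE) uE.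
split=> //; first exact: Ck_on_within_continuous cu.
  have t0I : t0 \in `[t0, T] by rewrite in_itv/= lexx ltW.
  have := mx_lip_on_ballsB (lip_on_balls_locally_lipschitz_in_x lf t0I)
    (mx_lip_on_ballsM lB (mx_lip_on_balls_cst 'cV[R]_n (phu P t0))).
  by congr mx_lip_on_balls; apply/funext => x; rewrite /ph_rhs addrK.
split=> //.
have := mx_lip_on_ballsM (mx_lip_on_ballsT lE) (lip_on_balls_gradient cH).
congr mx_lip_on_balls; apply/funext => x.
by rewrite -Ez mulmxA trmx_inv mulVmx ?mul1mx// unitmx_tr.
Qed.

Lemma energy_nonincreasing_substep (R : realType) n m s (t0 T h : R)
    (P : ph_data R n m) (c : 'I_s -> R) psi q :
  0 < h -> numerical_flow t0 T P (substep t0 T c) psi ->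
  energy_consistent_of_order P (substep t0 T c) psi q ->
  (forall x, phB P x = 0) ->
  forall (j : 'I_s) tau x x', tau \in `[t0, T] -> tau + h * c j \in `[t0, T] ->
    psi (tau + h * c j) tau x = Some x' ->
    phH P x' <= phH P x /\ ((forall y, phR P y = 0) -> phH P x' = phH P x).
Proof.
move=> h0 [psi0 _] [D [S [[dec _] _]]] B0 j tau x x' tauI tauI' psix.
have [cj0|cj0] := eqVneq (c j) 0.
  by move: psix; rewrite cj0 mulr0 addr0 psi0// => -[->].
have stp : substep t0 T c tau (h * c j).
  by split=> //; [rewrite mulf_neq0// gt_eqF|exists j, h].
have [energy D0 DR SB] := dec _ _ _ _ stp psix; move: energy; rewrite SB// addr0.
move=> energy; split; first by rewrite -subr_le0 energy.
by move=> /DR D00; apply/eqP; rewrite -subr_eq0 energy D00.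
Qed.

Lemma cvg_perturbation (R : realType) (F : set_system R) (FF : Filter F)
    (f g : R -> R) (l C : R) :
  id @ F --> (0 : R) -> (\forall h \near F, `|f h - g h| <= C * `|h|) ->
  f @ F --> l -> g @ F --> l.
Proof.
move=> F0 fg fl; have -> : l = l - 0 by rewrite subr0.
have -> : g = (fun h => f h - (f h - g h)) by apply/funext => h; rewrite subKr.
apply: cvgB => //; apply/cvgr0Pnorm_le => e e0.
have C0 : 0 < `|C| + 1 by rewrite ltr_wpDl.
have /cvgr0Pnorm_le/(_ (e / (`|C| + 1)) (divr_gt0 e0 C0)) := F0.
apply: filterS2 fg => h /= fgh; rewrite ler_pdivlMr// => he.
apply: le_trans fgh _; apply: le_trans he; rewrite mulrC ler_wpM2l//.
by rewrite (le_trans (ler_norm _))// lerDl.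
Qed.

Theorem proposition6 (R : realType) (n m s : nat) (t0 T : R)
    (E J Rd : 'cV[R]_n -> 'M[R]_n) (B : 'cV[R]_n -> 'M[R]_(n, m))
    (z : 'cV[R]_n -> 'cV[R]_n) (u : R -> 'cV[R]_m) (H : 'cV[R]_n -> R)
    (J1 J2 R1 R2 : 'cV[R]_n -> 'M[R]_n) (B1 B2 : 'cV[R]_n -> 'M[R]_(n, m))
    (a b : 'I_s -> R) (p q q1 q2 : nat) (psi1 psi2 : flow_map R n) :
  let P := PHData E J Rd B z u H in
  let P1 := PHData E J1 R1 B1 z u H in
  let P2 := PHData E J2 R2 B2 z u H in
  let f := ph_rhs P in let f1 := ph_rhs P1 in let f2 := ph_rhs P2 in
  let Psi := splitting_method a b (exact_flow t0 T P1) (exact_flow t0 T P2) in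
  let PsiA := splitting_method a b psi1 psi2 in
  let step := splitting_step t0 T a b in
  let step1 := substep t0 T a in
  let step2 := substep t0 T b in
  t0 < T ->
  is_pH P ->
  lipschitz_in_x t0 T f ->
  \sum_j a j = 1 -> \sum_j b j = 1 ->
  (* (i) *)
  is_pH P1 -> is_pH P2 ->
  (forall x, J x = J1 x + J2 x) ->
  (forall x, Rd x = R1 x + R2 x) ->
  (forall x, B x = B1 x + B2 x) ->
  (* (ii) *)
  locally_lipschitz_in_x t0 T f1 -> locally_lipschitz_in_x t0 T f2 ->
  Ck 1 B1 -> Ck 1 B2 ->
  (* (iii) *)
  ((forall x, B x = 0) -> (forall x, B1 x = 0) /\ (forall x, B2 x = 0)) ->
  (* (iv), (v) *)
  ((exists x, R1 x <> 0) -> forall j, 0 <= a j) ->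
  ((exists x, R2 x <> 0) -> forall j, 0 <= b j) ->
  (* (vi), with r = p *)
  (1 <= p <= 2)%N ->
  consistency_order t0 T P step Psi p ->
  Ck p.+1 H -> Ck p E -> Ck p B -> Ck p B1 -> Ck p B2 ->
  Ck_on p `[t0, T] u ->
  (p = 1%N -> [/\ lipschitz_in_x t0 T f, lipschitz_in_x t0 T f1
                & lipschitz_in_x t0 T f2]) ->
  (p = 2%N -> forall g : R -> 'cV[R]_n -> 'cV[R]_n,
     [\/ g = f, g = f1 | g = f2] ->
     Ck_on 1 [set tx : R * 'cV[R]_n | tx.1 \in `[t0, T]]
       (fun tx => g tx.1 tx.2)) ->
  (1 <= q <= 2)%N ->
  energy_consistent_of_order P step Psi q ->
  (q <= q1)%N -> (q <= q2)%N ->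
  numerical_flow t0 T P1 step1 psi1 -> numerical_flow t0 T P2 step2 psi2 ->
  energy_consistent_of_order P1 step1 psi1 q1 ->
  energy_consistent_of_order P2 step2 psi2 q2 ->
  energy_consistent_of_order P step PsiA q.
Proof.
move=> P P1 P2 f f1 f2 Psi PsiA step step1 step2 t0T _ _ _ _ pH1 pH2 _ RE _.
move=> lf1 lf2 cB1 cB2 B0 _ _ /andP[p1 p2] _ cH cE _ _ _ cu _ _ /andP[q1' q2'].
move=> [D [S [[dec lim] ener]]] qq1 qq2 num1 num2 en1 en2.
have cE1 : Ck 1 E by exact: Ck_le cE.
have cH2 : Ck 2 H by exact: Ck_le cH.
have reg1 : regular_pH t0 T P1 by exact: (smooth_regular_pH t0T pH1 lf1 cB1 cE1 cH2 cu).
have reg2 : regular_pH t0 T P2 by exact: (smooth_regular_pH t0T pH2 lf2 cB2 cE1 cH2 cu).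
have cl1 : close_substeps t0 T H q a (exact_flow t0 T P1) psi1.
  exact: (substep_estimates reg1 num1 en1 qq1).
have cl2 : close_substeps t0 T H q b (exact_flow t0 T P2) psi2.
  exact: (substep_estimates reg2 num2 en2 qq2).
have close := close_splitting_prefix q2' (leqnn s) cl1 cl2.
pose dH sg h x0 := if PsiA (sg + h) sg x0 is Some x1 then H x1 - H x0 else 0.
(* The sign of [D] is known only where [Psi] is defined; elsewhere the default 0 keeps [DA]
   nonpositive. *)
pose DA sg h x0 := if `[< forall x, B x = 0 >] then dH sg h x0
  else if Psi (sg + h) sg x0 is Some _ then D sg h x0 else 0.
pose SA sg h x0 := dH sg h x0 - DA sg h x0.
(* In either case one of the two differences is 0 and the other equals the difference of the final
   energies of [PsiA] and [Psi], which [close] bounds. Both the limits and the order follow from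
   this. *)
have approx (rho : R) : exists C delta, [/\ 0 < delta, 0 <= C &
    forall sg h x0, step sg h -> `|h| <= delta -> `|x0| <= rho ->
    exists x1, [/\ PsiA (sg + h) sg x0 = Some x1,
      `|DA sg h x0 - D sg h x0| <= C * `|h| ^+ q.+1
    & `|SA sg h x0 - S sg h x0| <= C * `|h| ^+ q.+1]].
  have [d [C [r [d0 C0 HC]]]] := close rho.
  exists C, d; split=> // sg h x0 stp hd xr.
  have h0 : 0 < h by case: stp.
  rewrite (gtr0_norm h0) in hd *.
  have [x1 [xA [Px1 PxA _ _ HxA]]] := HC _ _ _ stp hd xr.
  rewrite -splitting_methodE -/Psi in Px1.
  rewrite -splitting_methodE -/PsiA in PxA.
  have [HD D0 DR SB] := dec _ _ _ _ stp Px1.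
  have Ch : 0 <= C * h ^+ q.+1 by rewrite mulr_ge0// exprn_ge0// ltW.
  exists xA; split=> //; rewrite /SA /DA /dH PxA Px1.
    case: asboolP => [BE|_]; last by rewrite subrr normr0.
    have -> : D sg h x0 = H x1 - H x0 by rewrite HD SB// addr0.
    by rewrite opprB addrA subrK.
  case: asboolP => [BE|_]; first by rewrite SB// !subrr normr0.
  rewrite -addrA -opprD -HD.
  have -> : H xA - H x0 - (H x1 - H x0) = H xA - H x1 by ring.
  exact: HxA.
exists DA, SA; split; first split.
- move=> sg h x0 x1 stp PA1.
  have h0 : 0 < h by case: stp.
  have decrease : (forall x, B x = 0) -> H x1 <= H x0 /\
      ((forall x, Rd x = 0) -> H x1 = H x0).
    move=> BE; have [B10 B20] := B0 BE.
    have dec1 := energy_nonincreasing_substep h0 num1 en1 B10.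
    have dec2 := energy_nonincreasing_substep h0 num2 en2 B20.
    have := PA1; rewrite /PsiA splitting_methodE => PA1'.
    split.
      apply: (splitting_prefix_invariant (Q := fun x => H x <= H x0) stp _ _
        (leqnn s) PA1' (lexx _)) => j tau x x' tI tI' psix.
        exact: le_trans (dec1 _ _ _ _ tI tI' psix).1.
      exact: le_trans (dec2 _ _ _ _ tI tI' psix).1.
    move=> R0.
    have [psd1 psd2] : (forall x, psd (R1 x)) /\ (forall x, psd (R2 x)).
      by split; [case: pH1 | case: pH2].
    have R10 x : R1 x = 0 by apply: (psd_add_eq0 (psd1 x) (psd2 x)); rewrite -RE R0.
    have R20 x : R2 x = 0.
      by apply: (psd_add_eq0 (psd2 x) (psd1 x)); rewrite addrC -RE R0.
    apply: (splitting_prefix_invariant (Q := fun x => H x = H x0) stp _ _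
      (leqnn s) PA1' erefl) => j tau x x' tI tI' psix <-.
      exact: (dec1 _ _ _ _ tI tI' psix).2.
    exact: (dec2 _ _ _ _ tI tI' psix).2.
  have dHE : dH sg h x0 = H x1 - H x0 by rewrite /dH PA1.
  split.
  + by rewrite /SA dHE [RHS]addrC subrK.
  + rewrite /DA dHE; case: asboolP => [BE|_].
      by rewrite subr_le0; exact: (decrease BE).1.
    by case EP : (Psi _ _ _) => [y|//]; have [] := dec _ _ _ _ stp EP.
  + move=> R0; rewrite /DA dHE; case: asboolP => [BE|_].
      by rewrite ((decrease BE).2 R0) subrr.
    by case EP : (Psi _ _ _) => [y|//]; have [_ _ DR _] := dec _ _ _ _ stp EP; exact: DR.
  + by move=> BE; rewrite /SA /DA asboolT// subrr.
- move=> sg x0; have [limD limS] := lim sg x0.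
  have [C [d [d0 C0 HC]]] := approx `|x0|.
  have id0 : id @ within (step sg) (nbhs (0 : R)) --> (0 : R).
    exact: cvg_within.
  have near0 : \forall h \near within (step sg) (nbhs (0 : R)),
      [/\ 0 < h, h <= 1, h <= d & step sg h].
    rewrite near_withinE.
    have := near_dist_le (0 : R) ltr01; have := near_dist_le (0 : R) d0.
    apply: filterS2 => h; rewrite !sub0r !normrN => hd h1 stp.
    by split; [case: stp|exact: le_trans (ler_norm _) _|exact: le_trans (ler_norm _) _|].
  (* As [q >= 1], the error is at most [C * h ^+ 2], so it still tends to 0 after division by
     [h]. *)
  have quotient (v w h : R) : 0 < h -> h <= 1 -> `|v - w| <= C * `|h| ^+ q.+1 ->
      `|w / h - v / h| <= C * `|h|.
    move=> h0 h1; rewrite -mulrBl normrM normfV (gtr0_norm h0) ler_pdivrMr// distrC.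
    move/le_trans; apply; rewrite -mulrA ler_wpM2l// -expr2.
    by apply: ler_wiXn2l => //; rewrite ?ltW.
  split; [apply: (cvg_perturbation (C := C) _ id0 _ limD)
         |apply: (cvg_perturbation (C := C) _ id0 _ limS)];
    apply: filterS near0 => h [h0 h1 hd stp];
    have hd' : `|h| <= d by rewrite gtr0_norm.
  - by have [_ [_ HDA _]] := HC _ _ _ stp hd' (lexx _); exact: quotient.
  - by have [_ [_ _ HSA]] := HC _ _ _ stp hd' (lexx _); exact: quotient.
- move=> rho; have [C1 [d1 [d10 C10 H1]]] := approx rho.
  have [C2 [d2 [d20 H2]]] := ener rho.
  exists (C1 + C2), (Num.min d1 d2); split; first by rewrite lt_min d10.
  move=> sg h x0 stp; rewrite le_min => /andP[hd1 hd2] xr.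
  have [xA [PxA HDA HSA]] := H1 _ _ _ stp hd1 xr.
  (* The solution that witnesses the order of [Psi] serves for [PsiA] as well, so the two errors
     simply add. *)
  have [_ [x [_ solx HD HS]]] := H2 _ _ _ stp hd2 xr.
  have tri (v w y : R) c1 c2 : `|v - w| <= c1 -> `|w - y| <= c2 -> `|v - y| <= c1 + c2.
    by move=> vw wy; rewrite -(subrKA w) (le_trans (ler_normD _ _))// lerD.
  by exists xA, x; split=> //; rewrite mulrDl; [exact: tri HDA HD|exact: tri HSA HS].
Qed.
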